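(* Let $H$ be a separable complex Hilbert space. Then, with the closure taken in the operator norm topology of $\mathcal{B}(H)$, $$\overline{\{T\in\mathcal{B}(H):\ \sigma_p(T)=\sigma(T)\}}=\big\{T\in\mathcal{B}(H):\ \dim(\ker(T-\lambda\,\mathrm{id}_H))\neq 0\ \text{ for all } \lambda\in\rho_{sF}(T)\cap\sigma(T)\big\}.$$
   Context: $\mathcal{B}(H)$ is the algebra of bounded linear operators on $H$, $\sigma(T)$ is the spectrum of $T$, and the point spectrum $\sigma_p(T)$ is the set of all $\lambda\in\mathbb{C}$ with $\ker(T-\lambda\,\mathrm{id}_H)\neq\{0\}$. An operator $T\in\mathcal{B}(H)$ is semi-Fredholm if its image is closed and at least one of $\dim(\ker(T))$, $\dim(\ker(T^* ))$ is finite. $\rho_{sF}(T)$ is the set of all $\lambda\in\mathbb{C}$ such that $T-\lambda\,\mathrm{id}_H$ is semi-Fredholm. *)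

(* Defs.v *)
From HB Require Import structures.
From mathcomp Require Import all_boot all_order all_algebra.
From mathcomp Require Import boolp classical_sets functions cardinality reals.
From mathcomp Require Import topology normedtype complex.
From mathcomp Require Import lra.

Set Implicit Arguments.
Unset Strict Implicit.
Unset Printing Implicit Defensive.

Import Order.TTheory GRing.Theory Num.Theory.
Import numFieldNormedType.Exports.

Local Open Scope classical_set_scope.
Local Open Scope ring_scope.
Local Open Scope complex_scope.

HB.mixin Record NormedModule_isHilbert (R : realType) H
    & CompleteNormedModule R[i] H := {
  inner : H -> H -> R[i] ;
  inner_linearl : forall y : H, linear_for *%R (inner^~ y) ;
  inner_conj : forall x y : H, inner x y = (inner y x)^*%R ;
  inner_norm : forall x : H, inner x x = `|x| ^+ 2
}.

#[short(type="hilbertType")]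
HB.structure Definition Hilbert (R : realType) :=
  {H of CompleteNormedModule R[i] H & NormedModule_isHilbert R H}.

Definition separable_space (T : topologicalType) : Prop :=
  exists2 D : set T, countable D & dense D.

Section inner_product.
Context {R : realType} (H : hilbertType R).
Implicit Types x y z : H.

Lemma inner_bilinear :
  bilinear_for (GRing.Scale.Law.clone _ _ *%R _)
    (GRing.Scale.Law.clone _ _ ((Num.conj : R[i] -> R[i]) \; *%R) _)
    (@inner R H).
Proof.
split=> [y|x]; first exact: inner_linearl.
move=> a y z; rewrite inner_conj inner_linearl rmorphD rmorphM.
by rewrite (inner_conj x y) (inner_conj x z).
Qed.

Lemma inner_hermitian x y :
  inner x y = (-1) ^+ false * (inner y x)^*%R.
Proof. by rewrite expr0 mul1r inner_conj. Qed.

Lemma inner_gt0 x : x != 0 -> 0 < inner x x.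
Proof. by move=> x0; rewrite inner_norm exprn_gt0// normr_gt0. Qed.

HB.instance Definition _ := bilinear_isBilinear.Build R[i] H H R[i] _ _ (@inner R H) inner_bilinear.
HB.instance Definition _ := isHermitianSesquilinear.Build R[i] H false
  (Num.conj : R[i] -> R[i]) (@inner R H) inner_hermitian.
HB.instance Definition _ := isDotProduct.Build R[i] H (@inner R H) inner_gt0.

End inner_product.

Section bounded_operators.
Context {R : realType} (H : hilbertType R).

Definition is_bounded_operator : set (H -> H) :=
  [set f | linear f /\ exists M : R[i], forall x, `|f x| <= M * `|x|].

Definition bounded_operator_pred : {pred H -> H} := mem is_bounded_operator.

Lemma is_bounded_operator_submod : submod_closed bounded_operator_pred.
Proof.
split=> [|a f g]; rewrite !inE.
  split=> [a x y|]; first by rewrite scaler0 addr0.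
  by exists 0 => x; rewrite normr0 mul0r.
move=> -[lf [Mf fM]] [lg [Mg gM]]; split.
  move=> b x y; rewrite -[LHS]/(a *: f _ + g _) -[RHS]/(b *: (a *: f x + g x) + (a *: f y + g y)).
  rewrite lf lg !scalerDr !scalerA (mulrC a) -!addrA; congr (_ + _).
  by rewrite addrCA.
exists (`|a| * Mf + Mg) => x; rewrite -[in leLHS]/(a *: f _ + g _).
rewrite (le_trans (ler_normD _ _))// mulrDl lerD// normrZ -mulrA.
by rewrite ler_wpM2l.
Qed.

HB.instance Definition _ := GRing.isSubmodClosed.Build R[i] (H -> H)
  bounded_operator_pred is_bounded_operator_submod.

Record bounded_operator := BoundedOperator {
  bop_fun :> H -> H ;
  bop_funP : bop_fun \in bounded_operator_pred
}.

HB.instance Definition _ := [isSub for bop_fun].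
HB.instance Definition _ := [Choice of bounded_operator by <:].
HB.instance Definition _ :=
  [SubChoice_isSubLmodule of bounded_operator by <:].

Implicit Types S T : bounded_operator.

Lemma bop_linear T : linear T.
Proof. by have := bop_funP T; rewrite inE => -[]. Qed.

HB.instance Definition _ T := GRing.isLinear.Build R[i] H H _ T (bop_linear T).

Lemma bop_ext S T : S =1 T -> S = T.
Proof. by move=> ST; apply/val_inj/funext. Qed.

Lemma bopD S T x : (S + T) x = S x + T x. Proof. by []. Qed.
Lemma bopN T x : (- T) x = - T x. Proof. by []. Qed.
Lemma bopZ a T x : (a *: T) x = a *: T x. Proof. by []. Qed.
Lemma bop0 x : (0 : bounded_operator) x = 0. Proof. by []. Qed.

Lemma is_bounded_operator_id : idfun \in bounded_operator_pred.
Proof. by rewrite inE; split=> //; exists 1 => x; rewrite mul1r. Qed.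

Definition id_bop : bounded_operator := BoundedOperator is_bounded_operator_id.

(* The norm of a normedModType over R[i] is R[i]-valued, so the supremum of
   the real numbers |T x|, |x| <= 1, is computed in R and embedded back. *)
Definition opnorm T : R[i] :=
  (sup [set complex.Re `|T x| | x in [set x : H | `|x| <= 1]])%:C.

Lemma normReE (x : H) : (complex.Re `|x|)%:C = `|x|.
Proof. by rewrite RRe_real// normr_real. Qed.

Let opset_neq0 T :
  [set complex.Re `|T x| | x in [set x : H | `|x| <= 1]] !=set0.
Proof. by exists (complex.Re `|T 0|), 0 => //=; rewrite normr0. Qed.

Lemma opnorm_ge_unit T x : `|x| <= 1 -> `|T x| <= opnorm T.
Proof.
move=> x1; rewrite -normReE lecR; apply: ub_le_sup; last by exists x.
have := bop_funP T; rewrite inE => -[_ [M TM]].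
exists (complex.Re `|M|) => _ [y y1 <-].
rewrite -lecR normReE RRe_real ?normr_real// (le_trans (TM y))//.
have My0 : 0 <= M * `|y| := le_trans (normr_ge0 _) (TM y).
by rewrite -(ger0_norm My0) normrM normr_id ler_piMr.
Qed.

Lemma opnorm_le T (c : R) :
  (forall x, `|x| <= 1 -> `|T x| <= c%:C) -> opnorm T <= c%:C.
Proof.
move=> Tc; rewrite lecR; apply: ge_sup => // _ [x /= x1 <-].
by rewrite -lecR normReE Tc.
Qed.

Lemma opnorm_ge0 T : 0 <= opnorm T.
Proof. by apply: le_trans (opnorm_ge_unit T (x := 0) _); rewrite ?normr0. Qed.

Lemma opnorm_bound T x : `|T x| <= opnorm T * `|x|.
Proof.
have [->|x0] := eqVneq x 0; first by rewrite linear0 !normr0 mulr0.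
have nx0 : 0 < `|x| by rewrite normr_gt0.
rewrite -ler_pdivrMr// mulrC -[X in X * _](@ger0_norm _ `|x|^-1) ?invr_ge0//.
rewrite -normrZ -linearZ opnorm_ge_unit//.
by rewrite normrZ ger0_norm ?invr_ge0// mulVf ?gt_eqF.
Qed.

Lemma opnormD S T : opnorm (S + T) <= opnorm S + opnorm T.
Proof.
rewrite -rmorphD; apply: opnorm_le => x x1; rewrite rmorphD.
by rewrite bopD (le_trans (ler_normD _ _))// lerD// opnorm_ge_unit.
Qed.

Lemma opnormZ_le a T : opnorm (a *: T) <= `|a| * opnorm T.
Proof.
rewrite -[`|a|]RRe_real ?normr_real// -rmorphM; apply: opnorm_le => x x1.
rewrite rmorphM [X in X * _]RRe_real ?normr_real// bopZ normrZ ler_wpM2l//.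
exact: opnorm_ge_unit.
Qed.

Lemma opnormZ a T : opnorm (a *: T) = `|a| * opnorm T.
Proof.
apply/eqP; rewrite eq_le opnormZ_le/=.
have [->|a0] := eqVneq a 0; first by rewrite normr0 mul0r opnorm_ge0.
rewrite -ler_pdivlMl ?normr_gt0//.
by rewrite -[X in opnorm X <= _](scalerK a0) -normfV opnormZ_le.
Qed.

Lemma opnorm0_eq0 T : opnorm T = 0 -> T = 0.
Proof.
move=> T0; apply: bop_ext => x; apply/eqP; rewrite -normr_le0.
by rewrite (le_trans (opnorm_bound T x))// T0 mul0r.
Qed.

HB.instance Definition _ := Lmodule_isNormed.Build R[i] bounded_operator
  opnormD opnormZ opnorm0_eq0.

End bounded_operators.

Lemma divfX2K (F : fieldType) (a n : F) : n != 0 -> a / n ^+ 2 * n = a / n.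
Proof. by move=> n0; rewrite expr2 invfM mulrA mulfVK. Qed.

Section riesz.
Context {R : realType} (H : hilbertType R).
Implicit Types x y z : H.

Lemma normRe_ge0 x : 0 <= complex.Re `|x|.
Proof. by rewrite -lecR normReE; exact: normr_ge0. Qed.

Lemma parallelogram x y :
  `|x + y| ^+ 2 + `|x - y| ^+ 2 = (`|x| ^+ 2 + `|y| ^+ 2) *+ 2.
Proof.
rewrite -!inner_norm (dnormD (@inner R H)) (dnormB (@inner R H)) /=.
by rewrite addrACA subrr addr0 mulr2n.
Qed.


Lemma innerBl x y z : inner (x - y) z = inner x z - inner y z.
Proof. exact: (linearBl (@inner R H)). Qed.
Lemma innerBr x y z : inner x (y - z) = inner x y - inner x z.
Proof. exact: (linearBr (@inner R H)). Qed.
Lemma innerDr x y z : inner x (y + z) = inner x y + inner x z.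
Proof. exact: (linearDr (@inner R H)). Qed.
Lemma innerZl a x y : inner (a *: x) y = a * inner x y.
Proof. exact: (linearZl_LR (@inner R H)). Qed.
Lemma innerZr a x y : inner x (a *: y) = a^*%R * inner x y.
Proof. exact: (linearZr_LR (@inner R H)). Qed.
Lemma inner0r x : inner x 0 = 0.
Proof. exact: (linear0r (@inner R H)). Qed.

Lemma inner_inj x y : (forall z, inner z x = inner z y) -> x = y.
Proof.
move=> xy; apply/eqP; rewrite -subr_eq0 -normr_eq0 -sqrf_eq0 -inner_norm.
by rewrite innerBr xy subrr.
Qed.

Lemma norm_proj x y : y != 0 ->
  `|x - (inner x y / `|y| ^+ 2) *: y| ^+ 2 =
  `|x| ^+ 2 - `|inner x y| ^+ 2 / `|y| ^+ 2.
Proof.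
move=> y0; set a := inner x y; set n := `|y| ^+ 2.
have ngt0 : 0 < n by rewrite exprn_gt0// normr_gt0.
have n0 : n != 0 by rewrite gt_eqF.
have nR : n^*%R = n by rewrite conj_Creal// gtr0_real.
have dE : inner x ((a / n) *: y) = `|a| ^+ 2 / n.
  have cE : (a / n)^*%R = a^*%R / n.
    by rewrite rmorphM fmorphV; congr (_ * _^-1); exact: nR.
  by rewrite innerZr cE -/a normCK mulrAC (mulrC a).
have dR : (`|a| ^+ 2 / n)^*%R = `|a| ^+ 2 / n.
  by rewrite conj_Creal// ger0_real// divr_ge0// ?exprn_ge0// ltW.
rewrite -!inner_norm (dnormB (@inner R H)) /= dE dR !inner_norm.
rewrite normrZ exprMn -/n normrM normfV (gtr0_norm ngt0) expr_div_n.
have -> : `|a| ^+ 2 / n ^+ 2 * n = `|a| ^+ 2 / n.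
  exact: divfX2K.
by rewrite opprD addrA addrK.
Qed.

Lemma inner_cauchy_schwarz x y : `|inner x y| <= `|x| * `|y|.
Proof.
have [->|y0] := eqVneq y 0; first by rewrite inner0r normr0 mulr_ge0.
have := exprn_ge0 2 (normr_ge0 (x - (inner x y / `|y| ^+ 2) *: y)).
rewrite norm_proj// subr_ge0 ler_pdivrMr ?exprn_gt0 ?normr_gt0//.
by rewrite -exprMn ler_sqr ?nnegrE ?mulr_ge0//.
Qed.

Context (f : H -> R[i]) (lf : linear_for *%R f).
Context (M : R[i]) (fM : forall x, `|f x| <= M * `|x|).

Let fB x y : f (x - y) = f x - f y.
Proof. rewrite (addrC x) -scaleN1r lf. by rewrite mulN1r addrC. Qed.
Let f0 : f 0 = 0. Proof. by rewrite -(subrr 0) fB subrr. Qed.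
Let fZ a x : f (a *: x) = a * f x.
Proof. by rewrite -[a *: x]addr0 lf f0 addr0. Qed.
Let fD x y : f (x + y) = f x + f y.
Proof. by rewrite -[in LHS](scale1r x) lf mul1r. Qed.

Let A : set H := [set x | f x = 1].
Context (A0 : A !=set0).
Let D : set R := [set complex.Re `|x| | x in A].
Let d : R := inf D.

Let d_le x : A x -> d%:C <= `|x|.
Proof.
move=> Ax; rewrite -(normReE x) lecR; apply: ge_inf; last by exists x.
by exists 0 => _ [y Ay <-]; exact: normRe_ge0.
Qed.

Let d_ge0 : 0 <= d.
Proof.
apply: lb_le_inf; first by have [x Ax] := A0; exists (complex.Re `|x|), x.
by move=> _ [y Ay <-]; exact: normRe_ge0.
Qed.

Let Ad (e : R) : set H := [set x | A x /\ `|x| < (d + e)%:C].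

Let Ad0 e : 0 < e -> Ad e !=set0.
Proof.
move=> e0.
have hD : has_inf D.
  split; first by have [x Ax] := A0; exists (complex.Re `|x|), x.
  by exists 0 => _ [y Ay <-]; exact: normRe_ge0.
have [_ [x Ax <-] xe] := inf_adherent e0 hD.
by exists x; split => //; rewrite -(normReE x) ltcR.
Qed.

Let F := filter_from [set e : R | 0 < e] Ad.

Let FF : ProperFilter F.
Proof.
apply: filter_from_proper; last by move=> e /Ad0.
apply: filter_from_filter; first by exists 1 => /=.
move=> e1 e2 /= e10 e20; exists (Num.min e1 e2); first by rewrite /= lt_min e10.
move=> x [Ax xe]; split; split=> //; apply: (lt_le_trans xe);
  by rewrite lecR lerD2l ge_min lexx ?orbT.
Qed.

Let Ad_dist e x y : 0 < e -> Ad e x -> Ad e y ->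
  `|x - y| ^+ 2 <= (4 * (2 * d * e + e ^+ 2))%:C.
Proof.
move=> e0 [Ax xe] [Ay ye].
have -> : `|x - y| ^+ 2 = (`|x| ^+ 2 + `|y| ^+ 2) *+ 2 - `|x + y| ^+ 2.
  by rewrite -parallelogram addrAC subrr add0r.
have xy : A (2^-1 *: (x + y)).
  by rewrite /A/= fZ fD Ax Ay mulVf// pnatr_eq0.
have := d_le xy; rewrite normrZ normfV normr_nat ler_pdivlMl// => dxy.
have h (z : H) : `|z| < (d + e)%:C -> `|z| ^+ 2 <= ((d + e) ^+ 2)%:C.
  move=> ze; rewrite rmorphXn ler_sqr ?nnegrE//; first exact: ltW.
  by rewrite (le_trans _ (ltW ze)).
have {}dxy : (4 * d ^+ 2)%:C <= `|x + y| ^+ 2.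
  have -> : (4 * d ^+ 2)%:C = (2 * d%:C) ^+ 2 :> R[i].
    by rewrite exprMn -natrX rmorphM rmorph_nat rmorphXn.
  by rewrite ler_sqr ?nnegrE ?mulr_ge0// lecR.
rewrite lerBlDr (le_trans (y := (((d + e) ^+ 2) *+ 4)%:C))//.
  have -> : (((d + e) ^+ 2) *+ 4)%:C =
            (((d + e) ^+ 2)%:C + ((d + e) ^+ 2)%:C) *+ 2 :> R[i].
    by rewrite -mulr2n -mulrnA rmorphMn.
  by rewrite ler_wMn2r// lerD// h.
apply: (le_trans (y := (4 * (2 * d * e + e ^+ 2) + 4 * d ^+ 2)%:C)).
  by rewrite lecR -mulr_natl; lra.
by rewrite rmorphD lerD2l.
Qed.

#[local] Existing Instance FF.

Let Fcauchy : cauchy F.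
Proof.
apply/cauchy_ballP => eps eps0.
have /[!ltcE]/andP[/eqP/= im0 r0] := eps0.
set r := complex.Re eps in r0.
have epsE : eps = r%:C by apply/eqP; rewrite eq_complex/= eqxx im0 eqxx.
pose e : R := Num.min 1 (r ^+ 2 / (8 * (2 * d + 1))).
have dp : 0 < 8 * (2 * d + 1) by have := d_ge0; lra.
have e0 : 0 < e by rewrite lt_min ltr01 divr_gt0// exprn_gt0.
have e1 : e <= 1 by rewrite ge_min lexx.
have er : e * (8 * (2 * d + 1)) <= r ^+ 2.
  by rewrite -ler_pdivlMr// ge_min lexx orbT.
have key : 4 * (2 * d * e + e ^+ 2) < r ^+ 2.
  have := d_ge0; have : 0 < r ^+ 2 by rewrite exprn_gt0. nra.
exists (Ad e, Ad e); first by split; exists e.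
move=> [x y] /= [xA yA]; rewrite -ball_normE /= epsE.
rewrite -(@ltr_pXn2r _ 2)// ?nnegrE ?lecR ?(ltW r0)//.
by rewrite (le_lt_trans (Ad_dist e0 xA yA))// -rmorphXn ltcR.
Qed.

Let z := lim F.
Let Fz : F --> z. Proof. exact: cauchy_cvg. Qed.

Let z_adh (e : R) : 0 < e -> exists2 x, Ad e x & `|z - x| < e%:C.
Proof.
move=> e0.
have eC : 0 < e%:C :> R[i] by rewrite ltcR.
have Fe : F (ball z e%:C) by apply: Fz; exact: nbhsx_ballx.
have Fa : F (Ad e) by exists e.
have [x [? +]] := filter_ex (filterI Fa Fe).
by rewrite -ball_normE /= => ?; exists x.
Qed.

Let fz : f z = 1.
Proof.
apply/eqP; rewrite -subr_eq0 -normr_eq0 eq_le normr_ge0 andbT.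
rewrite -[`|_|](@RRe_real R) ?normr_real// lecR; apply/ler_addgt0Pr => eps eps0.
rewrite add0r -lecR RRe_real ?normr_real//.
pose m := complex.Re `|M|.
have m0 : 0 <= m by rewrite -lecR RRe_real ?normr_real//; exact: normr_ge0.
have mE : m%:C = `|M| by rewrite RRe_real ?normr_real.
have e0 : 0 < eps / (m + 1) by rewrite divr_gt0// ltr_wpDl.
have [x [Ax _] zx] := z_adh e0.
rewrite -[X in _ - X]Ax -fB (le_trans (fM _))//.
have Mzx : 0 <= M * `|z - x| := le_trans (normr_ge0 _) (fM _).
rewrite -(ger0_norm Mzx) normrM normr_id -mE.
rewrite (le_trans (y := m%:C * (eps / (m + 1))%:C))//.
  by apply: ler_wpM2l; [rewrite lecR|exact: ltW].
rewrite -rmorphM lecR mulrCA ler_piMr ?(ltW eps0)//.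
by rewrite ler_pdivrMr ?ltr_wpDl// mul1r lerDl.
Qed.

Let z_le : `|z| <= d%:C.
Proof.
rewrite -normReE lecR; apply/ler_addgt0Pr => eps eps0.
have e0 : 0 < eps / 2 by rewrite divr_gt0.
have [x [_ xe] zx] := z_adh e0.
rewrite -lecR normReE -[z](subrK x) (le_trans (ler_normD _ _))//.
rewrite (le_trans (lerD (ltW zx) (ltW xe)))// -rmorphD lecR; lra.
Qed.

Let z_ortho k : f k = 0 -> inner z k = 0.
Proof.
move=> fk; have [->|k0] := eqVneq k 0; first by rewrite inner0r.
have := d_le (x := z - (inner z k / `|k| ^+ 2) *: k).
rewrite /A/= fB fZ fk mulr0 subr0 => /(_ fz) dw.
have := norm_proj z k0; set w := `|_ - _| in dw * => wE.
have : `|z| ^+ 2 <= w ^+ 2.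
  have zw : `|z| <= w by exact: le_trans z_le dw.
  have w0 : 0 <= w by exact: normr_ge0.
  by rewrite ler_sqr ?nnegrE.
rewrite wE lerDl oppr_ge0 ler_pdivrMr ?exprn_gt0 ?normr_gt0// mul0r => h.
apply/eqP; rewrite -normr_eq0 -sqrf_eq0 eq_le h/=.
by rewrite exprn_ge0.
Qed.

Lemma riesz_nonzero : exists z, forall x, f x = inner x z.
Proof.
exists ((`|z| ^+ 2)^-1 *: z) => x.
have z0 : z != 0.
  by apply/eqP => z0; have /eqP := fz; rewrite z0 f0 eq_sym oner_eq0.
have : inner z (x - f x *: z) = 0 by apply: z_ortho; rewrite fB fZ fz mulr1 subrr.
move=> /(congr1 (Num.conj : R[i] -> R[i])).
rewrite -inner_conj rmorph0 innerBl innerZl inner_norm => /eqP.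
rewrite subr_eq0 => /eqP xz.
rewrite innerZr xz conj_Creal; last by rewrite rpredV rpredX// normr_real.
by rewrite mulrCA mulVf ?mulr1// expf_neq0// normr_eq0.
Qed.

End riesz.

Section adjoint.
Context {R : realType} {H : hilbertType R}.
Implicit Types x y z : H.

Lemma riesz (f : H -> R[i]) (M : R[i]) :
  linear_for *%R f -> (forall x, `|f x| <= M * `|x|) ->
  exists z, forall x, f x = inner x z.
Proof.
move=> lf fM.
have [fA|nfA] := pselect (exists x, f x = 1); first exact: (riesz_nonzero lf fM fA).
have f0 : f 0 = 0.
  by have := lf (-1) 0 0; rewrite scaler0 addr0 mulN1r addNr.
exists 0 => x; rewrite inner0r; apply/eqP/negPn/negP => fx0; apply: nfA.
by exists ((f x)^-1 *: x); rewrite -[_ *: _]addr0 lf f0 addr0 mulVf.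
Qed.

Lemma adjoint_exists (T : bounded_operator H) :
  exists S : bounded_operator H, forall x y, inner (T x) y = inner x (S y).
Proof.
have h y : exists z, forall x, inner (T x) y = inner x z.
  apply: (riesz (M := opnorm T * `|y|)).
    by move=> a u v; rewrite linearP inner_linearl.
  move=> x; rewrite (le_trans (inner_cauchy_schwarz _ _))// mulrAC.
  by rewrite ler_wpM2r// opnorm_bound.
have [S SE] := choice h.
suff SP : S \in @bounded_operator_pred R H by exists (BoundedOperator SP).
rewrite inE; split.
  move=> a u v; apply: inner_inj => x.
  by rewrite -SE !innerDr !innerZr !SE.
exists (opnorm T) => y.
have [->|Sy0] := eqVneq (S y) 0.
  by rewrite normr0 mulr_ge0// opnorm_ge0.
rewrite -(@ler_pM2l _ `|S y|) ?normr_gt0// -expr2 -inner_norm -SE.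
rewrite -[leLHS]ger0_norm; last by rewrite SE inner_norm exprn_ge0.
rewrite (le_trans (inner_cauchy_schwarz _ _))// mulrCA mulrA.
by rewrite ler_wpM2r// opnorm_bound.
Qed.

Definition adjoint (T : bounded_operator H) : bounded_operator H :=
  projT1 (cid (adjoint_exists T)).

Lemma adjointP (T : bounded_operator H) x y :
  inner (T x) y = inner x (adjoint T y).
Proof. exact: (projT2 (cid (adjoint_exists T))). Qed.

End adjoint.

Section spectrum.
Context {R : realType} {H : hilbertType R}.
Implicit Types (T : bounded_operator H) (V : set H) (lambda : R[i]).

Definition linearly_independent n (b : 'I_n -> H) : Prop :=
  forall c : 'I_n -> R[i], \sum_(i < n) c i *: b i = 0 -> forall i, c i = 0.

Definition linear_span n (b : 'I_n -> H) : set H :=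
  [set \sum_(i < n) c i *: b i | c in [set: 'I_n -> R[i]]].

(* An infinite-dimensional V satisfies has_dim V n for no n, so ~ has_dim V 0
   reads as dim V <> 0 in the extended sense. *)
Definition has_dim V n : Prop :=
  exists b : 'I_n -> H, linearly_independent b /\ V = linear_span b.

Definition finite_dimensional V : Prop := exists n, has_dim V n.

Definition kernel T : set H := T @^-1` [set 0].

Definition invertible T : Prop :=
  exists S : bounded_operator H, cancel T S /\ cancel S T.

Definition spectrum T : set R[i] :=
  [set lambda | ~ invertible (T - lambda *: id_bop H)].

Definition point_spectrum T : set R[i] :=
  [set lambda | kernel (T - lambda *: id_bop H) <> [set 0]].

Definition semi_fredholm T : Prop :=
  closed (range T) /\
  (finite_dimensional (kernel T) \/ finite_dimensional (kernel (adjoint T))).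

Definition rho_sF T : set R[i] :=
  [set lambda | semi_fredholm (T - lambda *: id_bop H)].

End spectrum.

(* Main.v *)
Require Import Defs.
From mathcomp Require Import all_boot all_order all_algebra.
From mathcomp Require Import ereal measure lebesgue_measure set_interval.
From mathcomp Require Import boolp classical_sets functions cardinality reals.
From mathcomp Require Import topology normedtype complex.
From mathcomp Require Import lra ring.

Set Implicit Arguments.
Unset Strict Implicit.
Unset Printing Implicit Defensive.

Import Order.TTheory GRing.Theory Num.Theory.
Import numFieldNormedType.Exports.

Local Open Scope classical_set_scope.
Local Open Scope ring_scope.
Local Open Scope complex_scope.

(** For the inclusion from left to right, let lambda be in rho_sF(T) and in
    sigma(T), and suppose that T - lambda is injective. Its range is closed, so
    by the open mapping theorem it is bounded below. If V is close to T and
    sigma_p(V) = sigma(V), then V - lambda is bounded below as well, so lambda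
    is not in sigma_p(V) = sigma(V) and V - lambda is invertible; its inverse
    obeys a bound that does not depend on V, and this forces T - lambda to be
    invertible ([closure_sub]).

    For the other inclusion, let T be in the right-hand side. Call a set of
    eigenvectors a cluster if each member is a limit of members with other
    eigenvalues, and let N be the closed span of all clusters. It is invariant
    under T, and (T - lambda) N is dense in N for every lambda
    ([cluster_span_dense]). Let S be the operator that T induces on the
    orthogonal complement of N. For each of the two operators, T on N and S on
    N^perp, cover the lambda in a large square at which it is not left
    semi-Fredholm by finitely many small discs centred at such points. At a centre mu there is an
    orthonormal sequence of approximate eigenvectors: a small correction turns
    them into exact ones, and a further small multiple of a weighted backward
    shift turns the diagonal operator into one for which the whole closed disc
    consists of eigenvalues. Outside the discs the modified block and the
    original one are both invertible, so the modification changes neither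
    injectivity nor surjectivity of the operator ([disc_perturbation]).

    Let T' be the result of doing this on N and on N^perp. On the discs of N
    the operator T' has eigenvectors in N. Off these discs, T - lambda is left
    semi-Fredholm on N, so its dense range is all of N, and T' - lambda maps N
    onto N too. Hence eigenvectors of the operator induced by T' on N^perp lift
    to eigenvectors of T', which settles the discs of N^perp. Off all discs
    there are two cases. If T - lambda has a kernel in N, then so has
    T' - lambda, as a surjective operator with a kernel keeps one under small
    perturbations. If T - lambda is bijective on N, then S - lambda is a limit
    of bijective operators S - mu ([nearby_invertible_quotient]). For otherwise
    T - mu would have a kernel for all mu = lambda + t with small t > 0: where
    it has none, its range is closed, mu is in rho_sF(T), and the hypothesis on
    T makes T - mu, hence S - mu, invertible. But in a separable space all except countably
    many of these uncountably many eigenvectors are condensation points of the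
    family, so they form a cluster and lie in N, where T - mu is injective.
    Therefore S - lambda behaves like an operator of index zero: a small
    perturbation of it that is injective is surjective ([fredholm_alternative_near]). In all
    cases T' - lambda is invertible or has a kernel. Compactness of the
    square makes the size of the admissible perturbations uniform
    ([uniform_perturbation]). *)

(** * Real-valued norms and elementary estimates *)

Section real_norm.
Context {R : realType}.

(** The norm of a normed module over R[i] is complex valued; [nr] is the same
    norm as an element of R, where the order is total. *)
Definition nr (V : normedZmodType R[i]) (x : V) : R := complex.Re `|x|.

Context {V : normedZmodType R[i]}.
Implicit Types x y z : V.

Lemma nrE x : (nr x)%:C = `|x|.
Proof. by rewrite /nr RRe_real// normr_real. Qed.

Lemma nr_ge0 x : 0 <= nr x.
Proof. by rewrite -lecR nrE; exact: normr_ge0. Qed.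

Lemma nr0 : nr (0 : V) = 0.
Proof. by rewrite /nr normr0. Qed.

Lemma nr_eq0 x : nr x = 0 -> x = 0.
Proof. by move=> x0; apply/eqP; rewrite -normr_eq0 -nrE x0. Qed.

Lemma nr_gt0 x : x != 0 -> 0 < nr x.
Proof.
move=> x0; rewrite lt_neqAle nr_ge0 andbT eq_sym.
by apply: contra_neq x0; exact: nr_eq0.
Qed.

Lemma nrD x y : nr (x + y) <= nr x + nr y.
Proof. by rewrite -lecR rmorphD /= !nrE; exact: ler_normD. Qed.

Lemma nrN x : nr (- x) = nr x.
Proof. by rewrite /nr normrN. Qed.

Lemma nrB x y : nr (x - y) <= nr x + nr y.
Proof. by rewrite -(nrN y) nrD. Qed.

Lemma nrC x y : nr (x - y) = nr (y - x).
Proof. by rewrite /nr distrC. Qed.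

Lemma nr_tri y x z : nr (x - z) <= nr (x - y) + nr (y - z).
Proof. by rewrite (le_trans _ (nrD _ _))// addrA subrK. Qed.

Lemma nrDr x y : nr x - nr y <= nr (x + y).
Proof. by have := nrB (x + y) y; rewrite addrK; lra. Qed.

Lemma nr_le x (c : R) : (`|x| <= c%:C) = (nr x <= c).
Proof. by rewrite -nrE lecR. Qed.

Lemma nr_lt x (c : R) : (`|x| < c%:C) = (nr x < c).
Proof. by rewrite -nrE ltcR. Qed.

(** Neighbourhoods are indexed by the positive elements of R[i], and these are
    just the positive reals. *)
Lemma posC (e : R[i]) : 0 < e -> exists2 r : R, 0 < r & e = r%:C.
Proof.
rewrite ltcE => /andP[/eqP/= im0 r0]; exists (complex.Re e) => //.
by apply/eqP; rewrite eq_complex/= im0 !eqxx.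
Qed.

End real_norm.

Section complex_norm.
Context {R : realType}.
Implicit Types a b : R[i].

Lemma nrM a b : nr (a * b) = nr a * nr b.
Proof. by apply: complexI; rewrite rmorphM /= !nrE normrM. Qed.

Lemma nrV a : nr a^-1 = (nr a)^-1.
Proof. by apply: complexI; rewrite fmorphV /= !nrE normfV. Qed.

Lemma nrX a n : nr (a ^+ n) = nr a ^+ n.
Proof. by apply: complexI; rewrite rmorphXn /= !nrE normrX. Qed.

Lemma nrR (r : R) : nr r%:C = `|r|.
Proof. by rewrite /nr normc_def /= expr0n addr0 sqrtr_sqr. Qed.

Lemma nrZ (V : normedModType R[i]) a (x : V) : nr (a *: x) = nr a * nr x.
Proof. by apply: complexI; rewrite rmorphM /= !nrE normrZ. Qed.

End complex_norm.

Section powers.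
Context {R : realType}.

Lemma bernoulli (h : R) n : 0 <= h -> 1 + n%:R * h <= (1 + h) ^+ n.
Proof.
move=> h0; elim: n => [|n ih]; first by rewrite mul0r addr0 expr0.
rewrite exprS; have : (1 + h) * (1 + n%:R * h) <= (1 + h) * (1 + h) ^+ n.
  by rewrite ler_wpM2l//; lra.
have : 0 <= n%:R * h * h :> R by rewrite !mulr_ge0// ler0n.
by rewrite -natr1; nra.
Qed.

Lemma exprn_small (q e : R) : 0 <= q -> q < 1 -> 0 < e -> exists n, q ^+ n < e.
Proof.
move=> q0 q1 e0; have [q00|qn0] := eqVneq q 0.
  by exists 1%N; rewrite q00 expr1.
have qp : 0 < q by rewrite lt_neqAle eq_sym qn0.
pose h := q^-1 - 1.
have h0 : 0 < h by rewrite subr_gt0 invf_gt1.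
pose n := Num.truncn (e^-1 / h); exists n.+1.
have : e^-1 < q^-1 ^+ n.+1.
  have -> : q^-1 = 1 + h by rewrite /h addrC subrK.
  apply: lt_le_trans (bernoulli _ (ltW h0)); have := truncnS_gt (e^-1 / h).
  by rewrite ltr_pdivrMr// -/n => ?; lra.
by rewrite exprVn ltf_pV2// posrE// exprn_gt0.
Qed.

(** With (1 + h) ^ 3 <= 1 / q, Bernoulli's inequality makes 1 / q ^ n grow at
    least like (1 + n h) ^ 3, faster than the square of n. *)
Lemma exprn_sqr_small (q : R) : 0 <= q -> q < 1 ->
  exists n, q ^+ n * n.+1%:R ^+ 2 < 1.
Proof.
move=> q0 q1; have [q00|qn0] := eqVneq q 0.
  by exists 1%N; rewrite q00 expr1 mul0r.
have qp : 0 < q by rewrite lt_neqAle eq_sym qn0.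
pose h := Num.min 1 ((q^-1 - 1) / 7).
have qi : 0 < q^-1 - 1 by rewrite subr_gt0 invf_gt1.
have h0 : 0 < h by rewrite lt_min ltr01 divr_gt0.
have h1 : h <= 1 by rewrite ge_min lexx.
have h7 : h * 7 <= q^-1 - 1 by rewrite -ler_pdivlMr// ge_min lexx orbT.
have h3 : (1 + h) ^+ 3 <= q^-1.
  have : h * h <= h by rewrite ler_piMl// ltW.
  have : h * h * h <= h * h by rewrite ler_piMr// mulr_ge0// ltW.
  rewrite !exprS expr0; nra.
have h30 : 0 < h ^+ 3 by rewrite exprn_gt0.
pose n := (Num.truncn (4 / h ^+ 3)).+1; exists n.
have n4 : 4 < n%:R * h ^+ 3 by rewrite -ltr_pdivrMr// truncnS_gt.
have n1 : 1 <= n%:R :> R by rewrite ler1n.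
rewrite -ltr_pdivlMl ?exprn_gt0// mulr1 -exprVn.
apply: (@lt_le_trans _ _ ((1 + n%:R * h) ^+ 3)); last first.
  apply: (@le_trans _ _ (((1 + h) ^+ n) ^+ 3)).
    by rewrite ler_pXn2r ?nnegrE ?exprn_ge0 ?bernoulli ?addr_ge0 ?mulr_ge0 ?ltW.
  rewrite -exprM mulnC exprM ler_pXn2r ?nnegrE ?exprn_ge0 ?invr_ge0//; lra.
rewrite -natr1; set u := n%:R in n4 n1 *.
have u0 : 0 < u by lra.
have : (u * h) ^+ 3 <= (1 + u * h) ^+ 3.
  have uh : 0 < u * h by rewrite mulr_gt0.
  by rewrite ler_pXn2r// ?nnegrE; lra.
have : u ^+ 2 * 4 < u ^+ 2 * (u * h ^+ 3) by rewrite ltr_pM2l ?exprn_gt0.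
have -> : u ^+ 2 * (u * h ^+ 3) = (u * h) ^+ 3 by ring.
have : (u + 1) ^+ 2 <= u ^+ 2 * 4 by nra.
lra.
Qed.

End powers.

Section hilbert.
Context {R : realType} {H : hilbertType R}.
Implicit Types (x y z : H) (T : bounded_operator H).

Lemma innerDl x y z : inner (x + y) z = inner x z + inner y z.
Proof. by rewrite -[x]scale1r inner_linearl mul1r scale1r. Qed.

Lemma inner0l x : inner 0 x = 0.
Proof. by rewrite inner_conj inner0r conjC0. Qed.

Lemma inner_suml (I : Type) (r : seq I) (P : pred I) (F : I -> H) y :
  inner (\sum_(i <- r | P i) F i) y = \sum_(i <- r | P i) inner (F i) y.
Proof. by apply: (big_morph (inner^~ y)) => [u v|]; rewrite ?innerDl ?inner0l. Qed.

Lemma inner_sumr (I : Type) (r : seq I) (P : pred I) (F : I -> H) y :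
  inner y (\sum_(i <- r | P i) F i) = \sum_(i <- r | P i) inner y (F i).
Proof. by apply: (big_morph (inner y)) => [u v|]; rewrite ?innerDr ?inner0r. Qed.

Lemma inner_xx x : inner x x = (nr x ^+ 2)%:C.
Proof. by rewrite inner_norm rmorphXn /= nrE. Qed.

Lemma inner_xx0 x : inner x x = 0 -> x = 0.
Proof.
rewrite inner_xx => /(congr1 (@complex.Re R))/= /eqP.
by rewrite sqrf_eq0 => /eqP /nr_eq0.
Qed.

Lemma inner_sym0 x y : inner x y = 0 -> inner y x = 0.
Proof. by move=> xy; rewrite inner_conj xy conjC0. Qed.

Lemma nr_inner x y : nr (inner x y) <= nr x * nr y.
Proof. by rewrite -lecR rmorphM /= !nrE; exact: inner_cauchy_schwarz. Qed.

Lemma pythagoras x y : inner x y = 0 -> nr (x + y) ^+ 2 = nr x ^+ 2 + nr y ^+ 2.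
Proof.
move=> xy; apply: complexI; rewrite rmorphD /= -!inner_xx innerDl !innerDr.
by rewrite xy (inner_sym0 xy) addr0 add0r.
Qed.

Lemma pythagoras_le x y : inner x y = 0 -> nr x <= nr (x + y).
Proof.
move=> /pythagoras xy; rewrite -(@ler_pXn2r _ 2)// ?nnegrE ?nr_ge0//.
by rewrite xy lerDl exprn_ge0// nr_ge0.
Qed.

Lemma nr_parallelogram x y :
  nr (x + y) ^+ 2 + nr (x - y) ^+ 2 = 2 * (nr x ^+ 2 + nr y ^+ 2).
Proof.
apply: complexI; rewrite mulr_natl rmorphMn !rmorphD /= !rmorphXn /= !nrE.
by rewrite parallelogram.
Qed.

Lemma opB T x y : T (x - y) = T x - T y. Proof. exact: linearB. Qed.
Lemma opD T x y : T (x + y) = T x + T y. Proof. exact: linearD. Qed.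
Lemma opZ T a x : T (a *: x) = a *: T x. Proof. exact: linearZ. Qed.
Lemma op0 T : T 0 = 0. Proof. exact: linear0. Qed.
Lemma opN T x : T (- x) = - T x. Proof. exact: linearN. Qed.

Lemma nrT T x : nr (T x) <= nr T * nr x.
Proof. by rewrite -lecR rmorphM /= !nrE; exact: opnorm_bound. Qed.

Lemma nrT_le T (c : R) : 0 <= c -> (forall x, nr (T x) <= c * nr x) -> nr T <= c.
Proof.
move=> c0 h; rewrite -nr_le; apply: opnorm_le => x; rewrite -[1]/(1%:C) !nr_le.
by move=> x1; rewrite (le_trans (h x))// ler_piMr.
Qed.

Lemma build_bop (f : H -> H) (c : R) :
  linear f -> (forall x, nr (f x) <= c * nr x) ->
  exists T : bounded_operator H, forall x, T x = f x.
Proof.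
move=> lf fc.
have fP : f \in @bounded_operator_pred R H.
  by rewrite inE; split=> //; exists c%:C => x; rewrite -!nrE -[_ * _]rmorphM lecR.
by exists (BoundedOperator fP).
Qed.

Lemma comp_bop_subproof (S T : bounded_operator H) :
  (S \o T) \in @bounded_operator_pred R H.
Proof.
rewrite inE; split; first by move=> a x y /=; rewrite !linearP.
exists (nr S * nr T)%:C => x; rewrite -!nrE -[_ * _]rmorphM lecR /= -mulrA.
by rewrite (le_trans (nrT S _))// ler_wpM2l ?nr_ge0// nrT.
Qed.

Definition comp_bop S T := BoundedOperator (comp_bop_subproof S T).

(** The modulus b is kept as a rate of convergence to the limit, so that later
    arguments need no filters. *)
Lemma cauchy_sequence_limit (s : nat -> H) (b : nat -> R) :
  (forall m n, (m <= n)%N -> nr (s n - s m) <= b m) ->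
  (forall e, 0 < e -> exists n, b n < e) ->
  exists x, forall n, nr (x - s n) <= b n.
Proof.
move=> sb b0.
have cs : cauchy (s @ \oo).
  apply/cauchy_ballP => eps /posC[e e0 ->].
  have [n bn] : exists n, b n < e / 2 by apply: b0; rewrite divr_gt0.
  exists ([set s k | k in [set k | (n <= k)%N]], [set s k | k in [set k | (n <= k)%N]]).
    by split; exists n => // k /= nk; exists k.
  move=> [_ _] /= [[k nk <-] [l nl <-]]; rewrite -ball_normE /= nr_lt.
  have := nr_tri (s n) (s k) (s l); have := sb _ _ nk; have := sb _ _ nl.
  by rewrite (nrC (s l)); lra.
have /cauchy_cvg cvs := cs; exists (lim (s @ \oo)) => n.
apply/ler_addgt0Pr => e e0.
have : (s @ \oo) (ball (lim (s @ \oo)) e%:C).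
  by apply: cvs; apply: nbhsx_ballx; rewrite ltcR.
case=> k _ /(_ (maxn k n)); rewrite /= leq_maxl => /(_ isT).
rewrite -ball_normE /= nr_lt => h.
have := nr_tri (s (maxn k n)) (lim (s @ \oo)) (s n).
by have := sb n (maxn k n) (leq_maxr _ _); lra.
Qed.

End hilbert.

(** * Closed subspaces, orthogonal projections and the open mapping theorem *)

Section subspaces.
Context {R : realType} {H : hilbertType R}.
Implicit Types (x y z : H) (T : bounded_operator H) (L : set H).

Definition lsubspace L := L 0 /\ forall a x y, L x -> L y -> L (a *: x + y).

(** The closure of L, with real radii. *)
Definition adherent L : set H :=
  [set x | forall e : R, 0 < e -> exists2 y, L y & nr (x - y) < e].

Definition csubspace L := lsubspace L /\ adherent L `<=` L.

Lemma subspD L x y : lsubspace L -> L x -> L y -> L (x + y).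
Proof. by move=> [_ h] Lx Ly; rewrite -[x]scale1r; exact: h. Qed.

Lemma subspZ L a x : lsubspace L -> L x -> L (a *: x).
Proof. by move=> [l0 h] Lx; rewrite -[_ *: _]addr0; exact: h. Qed.

Lemma subspN L x : lsubspace L -> L x -> L (- x).
Proof. by move=> sL Lx; rewrite -scaleN1r; exact: subspZ. Qed.

Lemma subspB L x y : lsubspace L -> L x -> L y -> L (x - y).
Proof. by move=> sL Lx Ly; apply: subspD => //; exact: subspN. Qed.

Lemma subsp_sum L (I : Type) (r : seq I) (F : I -> H) :
  lsubspace L -> (forall i, L (F i)) -> L (\sum_(i <- r) F i).
Proof.
move=> sL LF; elim/big_ind : _ => //; first by case: sL.
by move=> x y; exact: subspD.
Qed.

Lemma csub_setT : csubspace setT. Proof. by split. Qed.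

Lemma csubI (L1 L2 : set H) : csubspace L1 -> csubspace L2 -> csubspace (L1 `&` L2).
Proof.
move=> [[z1 l1] c1] [[z2 l2] c2]; split.
  by split=> // a x y [? ?] [? ?]; split; [exact: l1|exact: l2].
move=> x h; split; [apply: c1|apply: c2] => e /h[y [? ?] ?]; by exists y.
Qed.

Lemma csub_preimage T L : csubspace L -> csubspace (T @^-1` L).
Proof.
move=> [[z l] c]; split.
  split; first by rewrite /preimage/= linear0.
  by move=> a x y Lx Ly; rewrite /preimage/= linearP; exact: l.
move=> x h; apply: c => e e0.
have T1 : 0 < nr T + 1 by have := nr_ge0 T; lra.
have [y Ly xy] : exists2 y, (T @^-1` L) y & nr (x - y) < e / (nr T + 1).
  by apply: h; rewrite divr_gt0.
exists (T y) => //; rewrite -linearB (le_lt_trans (nrT _ _))//.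
move: xy; rewrite ltr_pdivlMr// => xy.
by have := nr_ge0 (x - y); have := nr_ge0 T; nra.
Qed.

Lemma csub_adherent L : lsubspace L -> csubspace (adherent L).
Proof.
move=> sL; split; last first.
  move=> x h e e0; have e20 : 0 < e / 2 by lra.
  have [y /(_ _ e20)[z Lz yz] xy] := h _ e20; exists z => //.
  by have := nr_tri y x z; lra.
split; first by move=> e e0; exists 0; [case: sL|rewrite subrr nr0].
move=> a x y ax ay e e0.
have a1 : 0 < nr a + 1 by have := nr_ge0 a; lra.
have [x' Lx' xx'] : exists2 x', L x' & nr (x - x') < e / 2 / (nr a + 1).
  by apply: ax; rewrite !divr_gt0.
have [y' Ly' yy'] : exists2 y', L y' & nr (y - y') < e / 2.
  by apply: ay; rewrite !divr_gt0.
exists (a *: x' + y'); first by case: sL => _; exact.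
rewrite opprD addrACA -scalerBr (le_lt_trans (nrD _ _))// nrZ.
move: xx'; rewrite ltr_pdivlMr// => xx'.
have := nr_ge0 a; have := nr_ge0 (x - x'); nra.
Qed.

Lemma adherent_sub L : L `<=` adherent L.
Proof. by move=> x Lx e e0; exists x => //; rewrite subrr nr0. Qed.

(** The closed linear span. Described from above, it lies in a given closed
    subspace as soon as L does, and no linear combinations are needed. *)
Definition hull L : set H := [set x | forall M, csubspace M -> L `<=` M -> M x].

Lemma csub_hull L : csubspace (hull L).
Proof.
split.
  split; first by move=> M [[]].
  by move=> a x y hx hy M cM LM; case: (cM) => -[_ l] _; apply: l; [exact: hx|exact: hy].
move=> x h M cM LM; case: (cM) => _; apply => e /h[y hy xy].
by exists y => //; exact: hy.
Qed.

Lemma sub_hull L : L `<=` hull L.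
Proof. by move=> x Lx M _; apply. Qed.

Definition orth L : set H := [set x | forall z, L z -> inner x z = 0].

Lemma csub_orth L : csubspace (orth L).
Proof.
split.
  split; first by move=> z _; rewrite inner0l.
  by move=> a x y hx hy z Lz; rewrite innerDl innerZl hx// hy// mulr0 addr0.
move=> x h z Lz; apply: nr_eq0; apply/eqP; rewrite eq_le nr_ge0 andbT.
apply/ler_addgt0Pr => e e0.
have z1 : 0 < nr z + 1 by have := nr_ge0 z; lra.
have [y Ly xy] : exists2 y, orth L y & nr (x - y) < e / (nr z + 1).
  by apply: h; rewrite divr_gt0.
rewrite -[inner x z]subr0 -(Ly z Lz) -innerBl (le_trans (nr_inner _ _))//.
move: xy; rewrite ltr_pdivlMr// => xy.
by have := nr_ge0 (x - y); have := nr_ge0 z; nra.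
Qed.

Lemma orth_disj L x : L x -> orth L x -> x = 0.
Proof. by move=> Lx ox; apply: inner_xx0; exact: ox. Qed.

End subspaces.

Section projection.
Context {R : realType} {H : hilbertType R}.
Implicit Types (x y z : H) (T : bounded_operator H) (L : set H).

Definition is_proj L (P : bounded_operator H) :=
  forall x, L (P x) /\ orth L (x - P x).

(** The parallelogram identity bounds the distance of two almost nearest points
    by the excess of their distances to x, so a minimizing sequence is Cauchy. *)
Lemma nearest_point L x : csubspace L ->
  exists2 y, L y & forall z, L z -> nr (x - y) <= nr (x - z).
Proof.
move=> [sL cL].
pose D : set R := [set nr (x - y) | y in L].
have hD : has_inf D.
  split; first by exists (nr (x - 0)), 0 => //; case: sL.
  by exists 0 => _ [y _ <-]; exact: nr_ge0.
pose d := inf D.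
have dle z : L z -> d <= nr (x - z).
  by move=> Lz; apply: ge_inf; [case: hD|exists z].
have d0 : 0 <= d by apply: lb_le_inf; [case: hD|move=> _ [y _ <-]; exact: nr_ge0].
have [t [t0 t1 tdec tsmall]] : exists t : nat -> R, [/\ forall n, 0 < t n,
    forall n, t n <= 1, forall m n, (m <= n)%N -> t n <= t m
    & forall e, 0 < e -> exists n, t n < e].
  exists (fun n => 2^-1 ^+ n); split=> [n|n|m n mn|e e0].
  - by rewrite exprn_gt0// invr_gt0.
  - by rewrite exprn_ile1// ?invr_ge0// invf_le1// ler1n.
  - by rewrite ler_wiXn2l// ?invr_ge0// invf_le1// ler1n.
  - by apply: exprn_small => //; lra.
have sE n : exists y, L y /\ nr (x - y) < d + t n.
  by have [_ [y Ly <-] ?] := inf_adherent (t0 n) hD; exists y.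
have [s sP] := choice sE.
(* Two points of L at distance less than d + t n from x have mutual distance at
   most b n, because their midpoint has distance at least d. *)
pose b n : R := Num.sqrt ((8 * d + 4) * t n).
have b0 e : 0 < e -> exists n, b n < e /\ t n < e.
  move=> e0; have e2 : 0 < Num.min e (e ^+ 2 / (8 * d + 4)).
    by rewrite lt_min e0 divr_gt0 ?exprn_gt0//; lra.
  have [n] := tsmall _ e2; rewrite lt_min => /andP[n1 n2]; exists n; split=> //.
  rewrite /b -(@ltr_pXn2r _ 2)// ?nnegrE ?sqrtr_ge0 ?(ltW e0)//.
  rewrite sqr_sqrtr; last by rewrite mulr_ge0 ?ltW//; lra.
  by move: n2; rewrite ltr_pdivlMr 1?mulrC//; lra.
have [y yP] : exists y, forall n, nr (y - s n) <= b n.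
  apply: cauchy_sequence_limit; last by move=> e /b0[n [bn _]]; exists n.
  move=> m n mn; have [[Lm sm] [Ln sn]] := (sP m, sP n).
  rewrite -(@ler_pXn2r _ 2)// ?nnegrE ?nr_ge0 ?sqrtr_ge0//.
  have tm0 := t0 m; have tm1 := t1 m; have tnm := tdec _ _ mn.
  rewrite sqr_sqrtr; last by rewrite mulr_ge0 ?ltW//; lra.
  have := nr_parallelogram (x - s m) (x - s n).
  rewrite (_ : x - s m - (x - s n) = s n - s m); last first.
    by rewrite opprB addrC addrA subrK.
  have := dle (2^-1 *: (s m + s n)).
  have -> : x - 2^-1 *: (s m + s n) = 2^-1 *: (x - s m + (x - s n)).
    rewrite addrACA -opprD scalerBr -mulr2n -[x *+ 2]scaler_nat scalerA.
    by rewrite mulVf ?pnatr_eq0 ?scale1r.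
  rewrite nrZ nrV.
  have -> : nr (2 : R[i]) = 2 by rewrite -[2]/(2%:R) -(rmorph_nat (real_complex R)) nrR ger0_norm.
  move=> /(_ (subspZ _ sL (subspD sL Lm Ln))) h.
  have := nr_ge0 (x - s m); have := nr_ge0 (x - s n).
  set u := nr (x - s m) in sm *; set v := nr (x - s n) in sn *.
  set w := nr (_ + _) in h *; set q := nr (s n - s m).
  move=> v0 u0 e.
  have : 4 * d ^+ 2 <= w ^+ 2.
    have we : w ^+ 2 = 4 * (2^-1 * w) ^+ 2 by field.
    by rewrite [leRHS]we ler_pM2l// ler_pXn2r// nnegrE; lra.
  have : u ^+ 2 <= (d + t m) ^+ 2 by rewrite ler_pXn2r// ?nnegrE; lra.
  have : v ^+ 2 <= (d + t m) ^+ 2 by rewrite ler_pXn2r// ?nnegrE; lra.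
  have : t m ^+ 2 <= t m by rewrite expr2 ler_piMl// ltW.
  nra.
exists y.
  apply: cL => e /b0[n [bn _]]; exists (s n); first by case: (sP n).
  exact: le_lt_trans (yP n) bn.
move=> z /dle; apply: le_trans; apply/ler_addgt0Pr => e e0.
have e2 : 0 < e / 2 by lra.
have [n [bn nn]] := b0 _ e2.
have := nr_tri (s n) x y; have := yP n; rewrite (nrC (s n)); have [_ ] := sP n.
by lra.
Qed.

(** Moving the nearest point along z cannot bring it nearer to x, which forces
    the component of x - y along z to vanish. *)
Lemma orth_projection_point L x : csubspace L -> exists y, L y /\ orth L (x - y).
Proof.
move=> cL; have [y Ly ymin] := nearest_point x cL; exists y; split=> // z Lz.
have [->|z0] := eqVneq z 0; first by rewrite inner0r.
have zz0 : inner z z != 0 by apply: contra_neq z0; exact: inner_xx0.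
set a := inner (x - y) z; pose w := (a / inner z z) *: z.
have wz : inner (x - y - w) z = 0 by rewrite innerBl innerZl mulfVK// subrr.
have ww : inner (x - y - w) w = 0 by rewrite innerZr wz mulr0.
have := pythagoras ww; rewrite subrK => e.
have := ymin (y + w); rewrite opprD addrA => /(_ (subspD (proj1 cL) Ly _)).
move=> /(_ (subspZ _ (proj1 cL) Lz)) h.
have w0 : nr w = 0.
  apply/eqP; rewrite -sqrf_eq0 eq_le exprn_ge0 ?nr_ge0// andbT.
  have : nr (x - y) ^+ 2 <= nr (x - y - w) ^+ 2 by rewrite ler_pXn2r// nnegrE nr_ge0.
  lra.
have /eqP := nr_eq0 w0; rewrite scaler_eq0 (negbTE z0) orbF mulf_eq0 invr_eq0.
by rewrite (negbTE zz0) orbF => /eqP.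
Qed.

Lemma proj_unique L x y : lsubspace L -> L y -> orth L (x - y) ->
  forall z, L z -> orth L (x - z) -> y = z.
Proof.
move=> sL Ly oy z Lz oz; apply/eqP; rewrite -subr_eq0; apply/eqP.
apply: (orth_disj (L := L)); first exact: subspB.
move=> t Lt; have -> : y - z = x - z - (x - y) by rewrite opprB [RHS]addrC addrA subrK.
by rewrite innerBl oy// oz// subrr.
Qed.

Lemma proj_exists L : csubspace L -> exists P, is_proj L P.
Proof.
move=> cL; have [p pP] := choice (fun x => orth_projection_point x cL).
have [sL _] := cL.
suff [P PE] : exists P : bounded_operator H, forall x, P x = p x.
  by exists P => x; rewrite PE.
apply: (build_bop (c := 1)).
  move=> a x y; have [[Lx ox] [Ly oy]] := (pP x, pP y).
  have [Lxy oxy] := pP (a *: x + y).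
  apply: (proj_unique sL Lxy oxy); first by case: sL => _; exact.
  by rewrite opprD addrACA -scalerBr; case: (csub_orth L) => -[_ l] _; exact: l.
move=> x; rewrite mul1r; have [Lx ox] := pP x.
by have := @pythagoras_le _ _ (p x) (x - p x) (inner_sym0 (ox _ Lx)); rewrite addrC subrK.
Qed.

Definition proj L : bounded_operator H := xget 0 (is_proj L).

Lemma projP L : csubspace L -> is_proj L (proj L).
Proof. by move=> /proj_exists[P PP]; exact: (xgetPex 0 (ex_intro _ P PP)). Qed.

Section proj_theory.
Context (L : set H) (cL : csubspace L).

Lemma projL x : L (proj L x). Proof. by case: (projP cL x). Qed.

Lemma proj_orth x : orth L (x - proj L x). Proof. by case: (projP cL x). Qed.

Lemma projE x y : L y -> orth L (x - y) -> proj L x = y.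
Proof. exact: (proj_unique (proj1 cL) (projL x) (@proj_orth x)). Qed.

Lemma proj_id x : L x -> proj L x = x.
Proof. by move=> Lx; apply: projE => // z; rewrite subrr inner0l. Qed.

Lemma proj_eq0 x : orth L x -> proj L x = 0.
Proof. by move=> ox; apply: projE; rewrite ?subr0//; case: cL => -[]. Qed.

Lemma nr_proj x : nr (proj L x) <= nr x.
Proof.
have := @pythagoras_le _ _ (proj L x) (x - proj L x).
by rewrite [proj L x + _]addrC subrK; apply; apply/inner_sym0/proj_orth/projL.
Qed.

Lemma proj_self x y : inner (proj L x) y = inner x (proj L y).
Proof.
rewrite -[in LHS](subrK (proj L y) y) innerDr -[in RHS](subrK (proj L x) x) innerDl.
rewrite (@proj_orth x _ (projL y)) (inner_sym0 (@proj_orth y _ (projL x))).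
by rewrite !add0r.
Qed.

Lemma orthK x : orth (orth L) x -> L x.
Proof.
move=> ox; suff /eqP : x - proj L x = 0 by rewrite subr_eq0 => /eqP ->; exact: projL.
apply: (orth_disj (@proj_orth x)); apply: subspB ox _ => //.
  exact: (proj1 (csub_orth _)).
by move=> z oz; apply: inner_sym0; apply: oz; exact: projL.
Qed.

End proj_theory.

End projection.

Section banach.
Context {R : realType} {H : hilbertType R}.
Implicit Types (x y z : H) (T A B : bounded_operator H) (L : set H).

Lemma geometric_limit (X : nat -> H) (c q : R) : 0 <= c -> 0 <= q -> q < 1 ->
  (forall n, nr (X n.+1 - X n) <= c * q ^+ n) ->
  exists x, forall n, nr (x - X n) <= c / (1 - q) * q ^+ n.
Proof.
move=> c0 q0 q1 XP; have q1' : 0 < 1 - q by lra.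
apply: cauchy_sequence_limit.
  move=> m n mn.
  suff: nr (X n - X m) <= c / (1 - q) * (q ^+ m - q ^+ n).
    move=> h; apply: le_trans h _; apply: ler_wpM2l; first by rewrite divr_ge0// ltW.
    by rewrite gerBl exprn_ge0.
  elim: n mn => [|n ih].
    by rewrite leqn0 => /eqP ->; rewrite !subrr nr0 mulr0.
  rewrite leq_eqVlt => /orP[/eqP ->|]; first by rewrite !subrr nr0 mulr0.
  rewrite ltnS => /ih {}ih; have := nr_tri (X n) (X n.+1) (X m); have := XP n.
  have : c / (1 - q) * (q ^+ n - q ^+ n.+1) = c * q ^+ n.
    by rewrite exprS; field; rewrite gt_eqF.
  by rewrite !mulrBr in ih *; lra.
move=> e e0; have [|||n nP] := @exprn_small _ q (e / (c / (1 - q) + 1)) => //.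
  by rewrite divr_gt0// ltr_wpDl// divr_ge0// ltW.
have c' : 0 <= c / (1 - q) by rewrite divr_ge0// ltW.
exists n; move: nP; rewrite ltr_pdivlMr ?ltr_wpDl// mulrC mulrDl mul1r.
by have := exprn_ge0 n q0; lra.
Qed.

(** Gliding hump: if h n in W has norm more than 4 ^ n, a step of length 3 ^ -n
    in one of the two directions +- h n makes the inner product with h n at
    least 3 ^ -n |h n|, and the later steps, of total length 3 ^ -n / 2, cannot
    undo this. The limit of the steps then has unbounded inner products. *)
Lemma uniform_boundedness (W : set H) :
  (forall x, exists C : R, forall h, W h -> nr (inner x h) <= C) ->
  exists C : R, forall h, W h -> nr h <= C.
Proof.
move=> Wb; apply: contrapT => nb.
have hE (n : nat) : exists h, W h /\ 4 ^+ n < nr h.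
  apply: contrapT => nh; apply: nb; exists (4 ^+ n) => h Wh.
  by rewrite leNgt; apply/negP => lt; apply: nh; exists h.
have [h hP] := choice hE.
have step (n : nat) x : exists y,
    nr (y - x) <= 1 * 3^-1 ^+ n /\ 3^-1 ^+ n * nr (h n) <= nr (inner y (h n)).
  set r := 3^-1 ^+ n.
  have r0 : 0 <= r by rewrite exprn_ge0// invr_ge0.
  have h0 : 0 < nr (h n) by have [_] := hP n; apply: lt_trans; rewrite exprn_gt0.
  pose s := (r / nr (h n))%:C *: h n.
  have sr : nr s = r.
    rewrite /s nrZ nrR ger0_norm; first by rewrite divfK ?gt_eqF.
    by rewrite divr_ge0// ltW.
  have sh : inner s (h n) = (r * nr (h n))%:C.
    by rewrite /s innerZl inner_xx -[LHS]rmorphM; congr (_%:C); field; rewrite gt_eqF.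
  have sh' : nr (inner s (h n)) = r * nr (h n).
    by rewrite sh nrR ger0_norm// mulr_ge0// ltW.
  have [p|p] := leP (r * nr (h n)) (nr (inner (x + s) (h n))).
    by exists (x + s); rewrite addrC addKr sr mul1r.
  exists (x - s); rewrite addrC addKr nrN sr mul1r; split=> //.
  have : nr (inner s (h n)) *+ 2 <= nr (inner (x + s) (h n)) + nr (inner (x - s) (h n)).
    apply: le_trans (nrB _ _); rewrite -innerBl.
    have -> : x + s - (x - s) = s + s by rewrite opprB addrC addrA subrK.
    rewrite innerDl -mulr2n -[leRHS]mulr1 -mulr_natl -[inner _ _ *+ 2]mulr_natl nrM mulr1.
    by rewrite -(rmorph_nat (real_complex R)) nrR ger0_norm// ler0n.
  by rewrite sh' mulr2n; lra.
have [g gP] := choice (fun p : nat * H => step p.1 p.2).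
pose X := fix X n := if n is m.+1 then g (m, X m) else 0.
have q1 : 3^-1 < 1 :> R by rewrite invf_lt1// ltr1n.
have q0 : 0 <= 3^-1 :> R by rewrite invr_ge0.
have [x xP] := geometric_limit ler01 q0 q1 (fun n => proj1 (gP (n, X n))).
have [C CP] := Wb x.
have lo n : 2^-1 * (4 / 3) ^+ n <= C.
  apply: le_trans (CP (h n) (proj1 (hP n))).
  have [_ /= lo] := gP (n, X n); have [_ h4] := hP n.
  have := xP n.+1; rewrite -/(X n.+1) in lo; rewrite exprS.
  have := nrDr (inner (X n.+1) (h n)) (inner (x - X n.+1) (h n)).
  rewrite -innerDl [_ + (x - _)]addrC subrK.
  have := nr_inner (x - X n.+1) (h n).
  have -> : 1 / (1 - 3^-1) * (3^-1 * 3^-1 ^+ n) = 2^-1 * 3^-1 ^+ n :> R by field.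
  rewrite exprMn; have r0 : 0 <= 3^-1 ^+ n :> R by rewrite exprn_ge0.
  set r := 3^-1 ^+ n in r0 lo *; move=> a b d.
  have : nr (x - X n.+1) * nr (h n) <= 2^-1 * r * nr (h n).
    by rewrite ler_wpM2r// nr_ge0.
  have : 4 ^+ n * r <= nr (h n) * r by rewrite ler_wpM2r// ltW.
  lra.
have [|||n] := @exprn_small _ (3 / 4) (2^-1 / (`|C| + 1)).
- lra.
- lra.
- by rewrite divr_gt0 ?invr_gt0// ltr_pwDr.
rewrite ltr_pdivlMr ?ltr_wpDl// => nP; have := lo n.
have e : (4 / 3) ^+ n * (3 / 4) ^+ n = 1 :> R.
  by rewrite -exprMn (_ : 4 / 3 * (3 / 4) = 1) ?expr1n//; field.
have p : 0 < (4 / 3) ^+ n :> R by apply: exprn_gt0; lra.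
have := ler_norm C; set u := (4 / 3) ^+ n in e p *.
set v := (3 / 4) ^+ n in e nP * => c1 c2.
have : u * (v * (`|C| + 1)) < u * 2^-1 by rewrite ltr_pM2l.
by rewrite mulrA e mul1r; lra.
Qed.

Lemma adjointPr T x y : inner (adjoint T x) y = inner x (T y).
Proof. by rewrite inner_conj -adjointP -inner_conj. Qed.

(** For x in H the inner products of x with the projections to L of the h such
    that |A^* h| <= 1 are bounded, because the projection of x to L is in the
    range of A. Uniform boundedness turns this into an inequality
    |proj h| <= C |A^* h|. Among the solutions of A x = y, the one in the
    closure of the range of A^* then has norm at most C |y|, since it can be
    tested against the vectors A^* h. *)
Theorem open_mapping A L : csubspace L -> range A = L ->
  exists2 C : R, 0 <= C & forall y, L y -> exists2 x, A x = y & nr x <= C * nr y.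
Proof.
move=> cL AL.
have LA x : L (A x) by rewrite -AL; exists x.
have [C CP] : exists C, forall h, [set proj L h | h in [set h | nr (adjoint A h) <= 1]] h -> nr h <= C.
  apply: uniform_boundedness => x.
  have := projL cL x; rewrite -{1}AL => -[z _ Az].
  exists (nr z) => _ [h /= h1 <-].
  rewrite -proj_self// -Az adjointP (le_trans (nr_inner _ _))//.
  by rewrite ler_piMr// nr_ge0.
have C0 : 0 <= C by apply: le_trans (CP 0 _); rewrite ?nr0//; exists 0 => /=; rewrite ?linear0 ?nr0.
(* Homogeneity turns the bound on the unit ball into one by |A^* h|; when
   A^* h = 0, all multiples of h are in the unit ball. *)
have hb h : nr (proj L h) <= C * nr (adjoint A h).
  have [A0|A0] := eqVneq (nr (adjoint A h)) 0.
    rewrite A0 mulr0 leNgt; apply/negP => p0.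
    pose a := (C + 1) / nr (proj L h).
    have a0 : 0 < a by rewrite divr_gt0//; lra.
    have := CP (proj L (a%:C *: h)); rewrite linearZ nrZ nrR gtr0_norm// /a divfK ?gt_eqF// => h1.
    suff: C + 1 <= C by lra.
    apply: h1; exists (a%:C *: h); last by rewrite linearZ.
    by rewrite /= linearZ /= nrZ A0 mulr0.
  have Ap : 0 < nr (adjoint A h) by rewrite lt_neqAle eq_sym A0 nr_ge0.
  have := CP (proj L ((nr (adjoint A h))^-1%:C *: h)).
  rewrite linearZ nrZ nrR ger0_norm ?invr_ge0 ?nr_ge0// ler_pdivrMl// mulrC; apply.
  exists ((nr (adjoint A h))^-1%:C *: h); last by rewrite linearZ.
  by rewrite /= linearZ /= nrZ nrR ger0_norm ?invr_ge0 ?nr_ge0// mulVf.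
(* Subtracting the component orthogonal to the range of A^*, which is in the
   kernel of A, does not change A z. *)
pose M := adherent (range (adjoint A)).
have cM : csubspace M.
  apply: csub_adherent; split; first by exists 0; rewrite ?linear0.
  by move=> a _ _ [x _ <-] [y _ <-]; exists (a *: x + y); rewrite ?linearP.
exists C => // y; rewrite -{1}AL => -[z _ Az]; exists (proj M z).
  apply/eqP; rewrite eq_sym -subr_eq0 -Az -linearB; apply/eqP/inner_xx0.
  rewrite adjointP; apply: (proj_orth cM).
  by apply: adherent_sub; eexists.
set x := proj M z.
have Ax : A x = y.
  apply/eqP; rewrite eq_sym -subr_eq0 -Az -linearB; apply/eqP/inner_xx0.
  by rewrite adjointP; apply: (proj_orth cM); apply: adherent_sub; eexists.
have xh h : nr (inner x (adjoint A h)) <= C * nr y * nr (adjoint A h).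
  have -> : inner x (adjoint A h) = inner y (proj L h).
    by rewrite -adjointP Ax -proj_self// proj_id// -Ax.
  by rewrite (le_trans (nr_inner _ _))// -mulrA mulrCA ler_wpM2l ?nr_ge0.
apply/ler_addgt0Pr => e e0.
have [x0|x0] := eqVneq (nr x) 0.
  by rewrite x0 addr_ge0 ?mulr_ge0 ?nr_ge0// ltW.
have xp : 0 < nr x by rewrite lt_neqAle eq_sym x0 nr_ge0.
have K0 : 0 <= C * nr y by rewrite mulr_ge0// nr_ge0.
have d0 : 0 < e * nr x / (nr x + C * nr y + 1) by rewrite divr_gt0 ?mulr_gt0//; lra.
have [_ [h _ <-]] := projL cM z _ d0; rewrite -/x ltr_pdivlMr; last by lra.
set g := adjoint A h => xg.
have := nr_inner x (x - g); rewrite innerBr inner_xx => i1.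
have i2 := xh h; rewrite -/g in i2.
have i3 : nr (nr x ^+ 2)%:C <= nr ((nr x ^+ 2)%:C - inner x g) + nr (inner x g).
  by have := nrD ((nr x ^+ 2)%:C - inner x g) (inner x g); rewrite subrK.
rewrite nrR ger0_norm ?exprn_ge0 ?nr_ge0// in i3.
have i4 : nr g <= nr x + nr (x - g) by have := nrB x (x - g); rewrite opprB addrC subrK.
have := nr_ge0 (x - g); set d := nr (x - g) in xg i1 i4 *.
have : nr x ^+ 2 <= nr x * d + C * nr y * (nr x + d).
  have : C * nr y * nr g <= C * nr y * (nr x + d) by rewrite ler_wpM2l.
  lra.
move=> i5 dge.
have : nr x * nr x <= nr x * (C * nr y + e).
  rewrite -expr2; apply: le_trans i5 _; nra.
by rewrite ler_pM2l.
Qed.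

End banach.

(** * Perturbation of bounded surjectivity *)

Section perturbation.
Context {R : realType} {H : hilbertType R}.
Implicit Types (x y z : H) (S T A B J : bounded_operator H) (L M : set H).

Definition maps L A := forall x, L x -> L (A x).

Definition injective_on L A := forall x, L x -> A x = 0 -> x = 0.

Definition surjective_on L A := forall y, L y -> exists2 x, L x & A x = y.

(** Surjectivity on L together with a bound on the preimages. The bound is what
    survives small perturbations. *)
Definition solves L A (C : R) :=
  forall y, L y -> exists x, [/\ L x, A x = y & nr x <= C * nr y].

Lemma solves_surjective L A C : solves L A C -> surjective_on L A.
Proof. by move=> h y /h[x [Lx Ax _]]; exists x. Qed.

Lemma surjective_solves L A : csubspace L -> maps L A -> surjective_on L A ->
  exists2 C : R, 0 < C & solves L A C.
Proof.
move=> cL mA sA; have [|C C0 CP] := @open_mapping _ _ (comp_bop A (proj L)) L cL.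
  rewrite eqEsubset; split=> [_ [x _ <-]|y /sA[x Lx <-]].
    by apply: (mA (proj L x)); apply: projL.
  by exists x => //=; rewrite proj_id.
exists (C + 1); first by lra.
move=> y /CP[x Ax xC]; exists (proj L x); split=> //; first exact: projL.
rewrite (le_trans (nr_proj cL _))// (le_trans xC)// ler_wpM2r ?nr_ge0//; lra.
Qed.

Lemma solves_injective_bound L A C : lsubspace L -> maps L A -> solves L A C ->
  injective_on L A -> forall x, L x -> nr x <= C * nr (A x).
Proof.
move=> sL mA sA iA x Lx; have [z [Lz Az zC]] := sA _ (mA _ Lx).
suff <- : z = x by rewrite Az.
apply/eqP; rewrite -subr_eq0; apply/eqP/iA; first exact: subspB.
by rewrite opB Az subrr.
Qed.

(** Solving approximately for the residual, again and again, gives a geometric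
    series that converges to an exact solution. *)
Lemma approximate_solution L B (C q : R) : csubspace L -> maps L B -> 0 <= C ->
  0 <= q -> q < 1 ->
  (forall y, L y -> exists x, [/\ L x, nr x <= C * nr y & nr (y - B x) <= q * nr y]) ->
  solves L B (C / (1 - q)).
Proof.
move=> cL mB C0 q0 q1 h; have [sL clL] := cL.
have hE y : exists x, L y -> [/\ L x, nr x <= C * nr y & nr (y - B x) <= q * nr y].
  by have [/h[x xP]|nL] := pselect (L y); [exists x|exists 0].
have [g gP] := choice hE.
move=> y Ly.
pose r := fix r n := if n is m.+1 then r m - B (g (r m)) else y.
pose X n := \sum_(i < n) g (r i).
have rP n : L (r n) /\ nr (r n) <= q ^+ n * nr y.
  elim: n => [|n [Lr rn]]; first by rewrite expr0 mul1r.
  have [Lg _ gq] := gP _ Lr; split; first by apply: subspB => //; exact: mB.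
  by rewrite /= (le_trans gq)// exprS -mulrA ler_wpM2l.
have XE n : y - B (X n) = r n.
  elim: n => [|n ih]; first by rewrite /X big_ord0 op0 subr0.
  by rewrite /X big_ord_recr /= opD opprD addrA -/(X n) ih.
have LX n : L (X n) by apply: subsp_sum => // i; case: (rP i) => /gP[].
have dX n : nr (X n.+1 - X n) <= C * nr y * q ^+ n.
  have -> : X n.+1 - X n = g (r n) by rewrite /X big_ord_recr /= [LHS]addrC addKr.
  have [Lr rn] := rP n.
  by have [_ gC _] := gP _ Lr; rewrite (le_trans gC)// -mulrA ler_wpM2l// mulrC.
have [x xP] := geometric_limit (mulr_ge0 C0 (nr_ge0 y)) q0 q1 dX.
set K := C * nr y / (1 - q) in xP.
have K0 : 0 <= K by rewrite divr_ge0 ?mulr_ge0 ?nr_ge0//; lra.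
have small e : 0 < e -> exists n, q ^+ n < e by move=> e0; exact: exprn_small.
have Lx : L x.
  apply: clL => e e0; have [|n nP] := small (e / (K + 1)); first by rewrite divr_gt0//; lra.
  exists (X n) => //; apply: le_lt_trans (xP n) _.
  move: nP; rewrite ltr_pdivlMr; last by lra.
  by have := exprn_ge0 n q0; nra.
exists x; split=> //.
  apply/eqP; rewrite -subr_eq0; apply/eqP/nr_eq0/eqP; rewrite eq_le nr_ge0 andbT.
  apply/ler_addgt0Pr => e e0; rewrite add0r.
  have Z0 : 0 <= nr B * K + nr y.
    by apply: addr_ge0; [apply: mulr_ge0 => //; exact: nr_ge0|exact: nr_ge0].
  have [|n nP] := small (e / (nr B * K + nr y + 1)); first by rewrite divr_gt0//; lra.
  have := nr_tri (B (X n)) (B x) y; rewrite -opB (nrC (B (X n)) y) XE.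
  have [_ rn] := rP n; have := nrT B (x - X n); have := xP n.
  move: nP; rewrite ltr_pdivlMr; last by lra.
  have := exprn_ge0 n q0; have := nr_ge0 B; set Q := q ^+ n in rn *.
  move=> B0 Q0 Qe xX BX tri.
  have : nr B * nr (x - X n) <= nr B * (K * Q) by rewrite ler_wpM2l.
  by lra.
have := xP 0%N; rewrite /X big_ord0 subr0 expr0 mulr1.
by rewrite /K mulrAC.
Qed.

Lemma solves_perturb L A B (C eta : R) : csubspace L -> maps L B -> 0 <= C ->
  solves L A C -> 0 <= eta -> eta * C <= 2^-1 ->
  (forall x, L x -> nr (A x - B x) <= eta * nr x) ->
  solves L B (C * 2).
Proof.
move=> cL mB C0 sA e0 eC AB.
rewrite (_ : C * 2 = C / (1 - 2^-1)); last by field.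
apply: (approximate_solution cL mB C0); [lra|lra|].
move=> y /sA[x [Lx Ax xC]]; exists x; split=> //.
rewrite -Ax (le_trans (AB _ Lx))// Ax; have := nr_ge0 y; have := nr_ge0 x.
move=> x0 y0; have : eta * nr x <= eta * (C * nr y) by rewrite ler_wpM2l.
have : eta * C * nr y <= 2^-1 * nr y by rewrite ler_wpM2r.
by lra.
Qed.

(** A vector x of the kernel of A is almost in the kernel of B: the solution z
    of B z = B x is shorter than x, and x - z is in the kernel of B. *)
Lemma kernel_perturb L A B (C eta : R) : csubspace L -> maps L B -> 0 <= C ->
  solves L A C -> 0 <= eta -> eta * C <= 4^-1 ->
  (forall x, L x -> nr (A x - B x) <= eta * nr x) ->
  ~ injective_on L A -> ~ injective_on L B.
Proof.
move=> cL mB C0 sA e0 eC AB niA iB; apply: niA => x Lx Ax.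
have [|z [Lz Bz zC]] := solves_perturb cL mB C0 sA e0 _ AB (mB _ Lx); first by lra.
have : x - z = 0.
  by apply: iB; [apply: subspB => //; case: cL|rewrite opB Bz subrr].
move=> /eqP; rewrite subr_eq0 => /eqP xz.
have := AB _ Lx; rewrite Ax sub0r nrN => Bx.
apply: nr_eq0; apply/eqP; rewrite eq_le nr_ge0 andbT.
rewrite -xz in zC; have := nr_ge0 x => x0.
have : C * 2 * nr (B x) <= C * 2 * (eta * nr x) by rewrite ler_wpM2l// mulr_ge0.
have : eta * C * nr x <= 4^-1 * nr x by rewrite ler_wpM2r.
by lra.
Qed.

Lemma injective_perturb L A B (C eta : R) : 0 < C ->
  (forall x, L x -> nr x <= C * nr (A x)) -> eta * C <= 2^-1 ->
  (forall x, L x -> nr (A x - B x) <= eta * nr x) ->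
  forall x, L x -> nr x <= C * 2 * nr (B x).
Proof.
move=> C0 bA eC AB x Lx; have := bA _ Lx; have := AB _ Lx.
have := nrDr (A x) (- B x); rewrite nrN => a b c.
have : C * nr (A x) <= C * (nr (B x) + eta * nr x) by rewrite ler_pM2l//; lra.
have : eta * C * nr x <= 2^-1 * nr x by rewrite ler_wpM2r// nr_ge0.
by lra.
Qed.

Lemma bounded_below_injective L A (C : R) :
  (forall x, L x -> nr x <= C * nr (A x)) -> injective_on L A.
Proof.
move=> h x Lx Ax; apply: nr_eq0; apply/eqP; rewrite eq_le nr_ge0 andbT.
by have := h _ Lx; rewrite Ax nr0 mulr0.
Qed.

Lemma bijective_invertible A :
  injective_on setT A -> surjective_on setT A -> invertible A.
Proof.
move=> iA sA; have [C C0 CP] := surjective_solves csub_setT (fun _ _ => Logic.I) sA.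
have [g gP] := choice (fun y => CP y Logic.I).
have gK : cancel A g.
  move=> x; apply/eqP; rewrite -subr_eq0; apply/eqP/iA => //.
  by rewrite opB; have [_ -> _] := gP (A x); rewrite subrr.
have [||S SE] := @build_bop _ _ g C.
- move=> a x y; have [_ <- _] := gP x; have [_ <- _] := gP y.
  by rewrite -linearP !gK.
- by move=> x; case: (gP x).
exists S; split=> x; rewrite SE //.
by case: (gP x).
Qed.

Lemma invertible_bijective A : invertible A ->
  injective_on setT A /\ surjective_on setT A.
Proof.
move=> [S [AS SA]]; split=> [x _ Ax|y _]; last by exists (S y).
by rewrite -(AS x) Ax op0.
Qed.

Lemma kernel_trivialP A : kernel A = [set 0] <-> injective_on setT A.
Proof.
split=> [kA x _ Ax|iA]; first by have : kernel A x by []; rewrite kA.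
rewrite eqEsubset; split=> [x /iA -> //|x ->]; by rewrite /kernel/= op0.
Qed.

Lemma has_dim0P A : has_dim (kernel A) 0 <-> injective_on setT A.
Proof.
rewrite -kernel_trivialP; split=> [[b [_ ->]]|->].
  rewrite eqEsubset; split=> [_ [c _ <-]|_ ->]; first by rewrite big_ord0.
  by exists (fun _ => 0) => //; rewrite big_ord0.
exists (fun _ => 0); split=> [c _ [] //|].
rewrite eqEsubset; split=> [_ ->|_ [c _ <-]]; last by rewrite /= big_ord0.
by exists (fun _ => 0) => //; rewrite big_ord0.
Qed.

Lemma closed_csub L : lsubspace L -> closed L -> csubspace L.
Proof.
move=> sL cL; split=> // x h; apply: cL => B /nbhs_ballP[e /=].
move=> /posC[r r0 ->] eB; have [y Ly xy] := h _ r0; exists y; split=> //; apply: eB.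
by rewrite -ball_normE /= nr_lt.
Qed.

Lemma csub_closed L : csubspace L -> closed L.
Proof.
move=> [_ cL] x cx; apply: cL => e e0.
have [|y [Ly]] := cx (ball x e%:C); first by apply: nbhsx_ballx; rewrite ltcR.
by rewrite -ball_normE /= nr_lt => ?; exists y.
Qed.

Lemma range_subsp A : lsubspace (range A).
Proof.
split; first by exists 0; rewrite ?op0.
by move=> a _ _ [x _ <-] [y _ <-]; exists (a *: x + y); rewrite ?linearP.
Qed.

Lemma closure_opnorm (F : set (bounded_operator H)) T : closure F T <->
  forall e : R, 0 < e -> exists2 S, F S & nr (T - S) < e.
Proof.
split=> [cT e e0|h].
  have [|S [FS]] := cT (ball T e%:C); first by apply: nbhsx_ballx; rewrite ltcR.
  by rewrite -ball_normE /= nr_lt => ?; exists S.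
move=> B /nbhs_ballP[e /=] /posC[r r0 ->] eB.
have [S FS TS] := h _ r0; exists S; split=> //; apply: eB.
by rewrite -ball_normE /= nr_lt.
Qed.

(** A bounded below operator that is a limit of invertible operators is
    invertible, since their inverses are uniformly bounded. *)
Lemma closure_sub T : closure [set T | point_spectrum T = spectrum T] T ->
  forall lambda : R[i], (rho_sF T `&` spectrum T) lambda ->
    ~ has_dim (kernel (T - lambda *: id_bop H)) 0%N.
Proof.
move=> /closure_opnorm cT lambda [[rcl _] ninv] /has_dim0P inj; apply: ninv.
set A := (T - _ : bounded_operator H) in rcl inj *.
apply: bijective_invertible => //.
have [C C0 CP] := open_mapping (closed_csub (range_subsp A) rcl) (erefl _).
have bA x : setT x -> nr x <= (C + 1) * nr (A x).
  move=> _; have [|z Az zC] := CP (A x); first by exists x.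
  have -> : x = z.
    apply/eqP; rewrite -subr_eq0; apply/eqP/inj => //.
    by rewrite opB Az subrr.
  rewrite (le_trans zC)// Az ler_wpM2r ?nr_ge0//; lra.
have e0 : 0 < (C + 1)^-1 / 4 by rewrite divr_gt0// invr_gt0; lra.
have eC : (C + 1)^-1 / 4 * (C + 1) <= 4^-1 by rewrite mulrAC mulVf ?mul1r// gt_eqF//; lra.
have [S ST TS] := cT _ e0.
pose B : bounded_operator H := S - lambda *: id_bop H.
have AB x : setT x -> nr (A x - B x) <= (C + 1)^-1 / 4 * nr x.
  move=> _; have -> : A x - B x = (T - S) x.
    by rewrite /A /B !bopD !bopN opprD opprK addrACA addNr addr0.
  by rewrite (le_trans (nrT _ _))// ler_wpM2r ?nr_ge0// ltW.
have iB : injective_on setT B.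
  apply: bounded_below_injective; apply: (injective_perturb _ bA _ AB); lra.
have invB : invertible B.
  apply: contrapT => nB; have : spectrum S lambda by [].
  by rewrite -ST => h; apply: h; apply/kernel_trivialP.
have [_ sB] := invertible_bijective invB.
have bB x : setT x -> nr x <= (C + 1) * 2 * nr (B x).
  by apply: (injective_perturb _ bA _ AB); lra.
have solB : solves setT B ((C + 1) * 2).
  by move=> y /sB[x _ Bx]; exists x; split=> //; rewrite -Bx; exact: bB.
apply: (@solves_surjective _ _ ((C + 1) * 2 * 2)).
apply: (solves_perturb csub_setT _ _ solB (eta := (C + 1)^-1 / 4)) => //.
- by rewrite mulr_ge0//; lra.
- lra.
- lra.
- by move=> x _; rewrite nrC; exact: AB.
Qed.

End perturbation.

(** * Left semi-Fredholm operators and closed ranges *)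

Section semi_fredholm.
Context {R : realType} {H : hilbertType R}.
Implicit Types (x y z : H) (S T A B : bounded_operator H) (L M V : set H).

Definition orthonormal_family n (p : 'I_n -> H) :=
  forall i j, inner (p i) (p j) = (i == j)%:R.

Definition perp n (p : 'I_n -> H) : set H :=
  [set x | forall i, inner x (p i) = 0].

(** A closed range and a finite-dimensional kernel, expressed by a lower bound
    for A off a finite-dimensional subspace. In this form the notion is visibly
    stable, and its failure directly yields approximate eigenvectors. *)
Definition left_sF L A := exists n (p : 'I_n -> H) (c : R),
  [/\ orthonormal_family p, forall i, L (p i), 0 < c &
      forall x, L x -> perp p x -> nr x <= c * nr (A x)].

Lemma perpE n (p : 'I_n -> H) : perp p = orth (range p).
Proof.
rewrite eqEsubset; split=> [x xp _ [i _ <-]|x xp i]; first exact: xp.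
by apply: xp; exists i.
Qed.

Lemma csub_perp L n (p : 'I_n -> H) : csubspace L -> csubspace (L `&` perp p).
Proof. by move=> cL; apply: csubI => //; rewrite perpE; exact: csub_orth. Qed.

Lemma perp_decomposition L n (p : 'I_n -> H) x : lsubspace L -> orthonormal_family p ->
  (forall i, L (p i)) -> L x ->
  (L `&` perp p) (x - \sum_i inner x (p i) *: p i).
Proof.
move=> sL op Lp Lx; split.
  by apply: subspB => //; apply: subsp_sum => // i; exact: subspZ.
move=> j; rewrite innerBl inner_suml (bigD1 j)//= innerZl op eqxx mulr1.
rewrite big1 ?addr0 ?subrr// => i ij.
by rewrite innerZl op (negbTE ij) mulr0.
Qed.

Lemma image_subsp V A : lsubspace V -> lsubspace (A @` V).
Proof.
move=> [v0 vl]; split; first by exists 0; rewrite ?op0.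
move=> a _ _ [x Vx <-] [y Vy <-]; exists (a *: x + y); first exact: vl.
by rewrite opD opZ.
Qed.

(** The lower bound makes preimages of a Cauchy sequence a Cauchy sequence. *)
Lemma image_csub V A (c : R) : csubspace V ->
  (forall x, V x -> nr x <= c * nr (A x)) -> csubspace (A @` V).
Proof.
move=> cV h; have [sV clV] := cV; split; first exact: image_subsp.
move=> y ay.
pose t n : R := 2^-1 ^+ n.
have t0 n : 0 < t n by rewrite exprn_gt0// invr_gt0.
have tle m n : (m <= n)%N -> t n <= t m.
  by move=> mn; rewrite ler_wiXn2l// ?invr_ge0// invf_le1// ler1n.
have tsmall e : 0 < e -> exists n, t n < e by move=> e0; apply: exprn_small => //; lra.
have xE n : exists x, V x /\ nr (y - A x) < t n.
  by have [_ [x Vx <-] ?] := ay _ (t0 n); exists x.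
have [x xP] := choice xE.
have d m n : (m <= n)%N -> nr (x n - x m) <= `|c| * 2 * t m.
  move=> /tle tnm; have [[Vm ym] [Vn yn]] := (xP m, xP n).
  have := h _ (subspB sV Vn Vm); rewrite opB.
  have := nr_tri y (A (x n)) (A (x m)); rewrite (nrC _ y) => tri.
  have := ler_wpM2r (nr_ge0 (A (x n) - A (x m))) (ler_norm c).
  have : `|c| * nr (A (x n) - A (x m)) <= `|c| * (t m + t m).
    by rewrite ler_wpM2l ?normr_ge0//; lra.
  by lra.
have b0 e : 0 < e -> exists n, `|c| * 2 * t n < e /\ t n < e.
  move=> e0; have c1 : 0 < `|c| * 2 + 1 by have := normr_ge0 c; lra.
  have [|n] := tsmall (e / (`|c| * 2 + 1)); first by rewrite divr_gt0.
  rewrite ltr_pdivlMr// => ne; exists n; have := t0 n; have := normr_ge0 c.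
  by split; nra.
have [z zP] : exists z, forall n, nr (z - x n) <= `|c| * 2 * t n.
  by apply: cauchy_sequence_limit d _ => e /b0[n [? _]]; exists n.
exists z.
  apply: clV => e /b0[n [ne _]]; exists (x n); first by case: (xP n).
  exact: le_lt_trans (zP n) ne.
apply/eqP; rewrite -subr_eq0; apply/eqP/nr_eq0/eqP; rewrite eq_le nr_ge0 andbT.
apply/ler_addgt0Pr => e e0; rewrite add0r.
have e1 : 0 < e / 2 / (nr A + 1).
  by apply: divr_gt0; [lra|have := nr_ge0 A; lra].
have A1 : 0 < nr A + 1 by have := nr_ge0 A; lra.
have [n []] := b0 _ e1; rewrite !ltr_pdivlMr// => n1 n2.
have := nr_tri (A (x n)) (A z) y; rewrite -opB (nrC (A (x n)) y).
have := nrT A (z - x n); have A0 := nr_ge0 A; have [_ yx] := xP n; have zx := zP n.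
move=> Azx tri.
have X0 : 0 <= `|c| * 2 * t n by rewrite !mulr_ge0// ltW.
set X := `|c| * 2 * t n in n1 zx X0.
have : nr A * nr (z - x n) <= nr A * X by rewrite ler_wpM2l.
have : 0 <= nr A * t n by rewrite mulr_ge0// ltW.
by lra.
Qed.

(** Only the component u of w orthogonal to V counts, and its coefficient is an
    inner product. So the set is the preimage of V under the operator that
    removes this component. *)
Lemma csub_add_line V w : csubspace V -> csubspace [set z | exists a v, V v /\ z = v + a *: w].
Proof.
move=> cV; have [sV clV] := cV.
pose u := w - proj V w.
have [u0|u0] := eqVneq u 0.
  have Vw : V w by move/eqP: u0; rewrite subr_eq0 => /eqP ->; exact: projL.
  suff -> : [set z | exists a v, V v /\ z = v + a *: w] = V by [].
  rewrite eqEsubset; split=> [_ [a [v [Vv ->]]]|z Vz].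
    by apply: subspD => //; exact: subspZ.
  by exists 0, z; rewrite scale0r addr0.
have uu : inner u u != 0 by apply: contra_neq u0; exact: inner_xx0.
have [|| Q QE] := @build_bop R H (fun z => z - (inner z u / inner u u) *: u) (1 + nr (inner u u)^-1 * nr u ^+ 2).
- move=> a x y; rewrite inner_linearl mulrDl -mulrA scalerDl -scalerA.
  by rewrite [a *: (x - _)]scalerBr opprD addrACA.
- move=> x; rewrite (le_trans (nrB _ _))// mulrDl mul1r lerD2l nrZ nrM.
  have i0 := nr_ge0 (inner u u)^-1; have u0' := nr_ge0 u.
  have : nr (inner x u) * nr (inner u u)^-1 * nr u <=
         nr x * nr u * nr (inner u u)^-1 * nr u.
    by rewrite ler_wpM2r// ler_wpM2r// nr_inner.
  by lra.
suff -> : [set z | exists a v, V v /\ z = v + a *: w] = Q @^-1` V by exact: csub_preimage.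
rewrite eqEsubset; split=> [_ [a [v [Vv ->]]]|z]; rewrite /preimage /= QE.
  have -> : v + a *: w = (v + a *: proj V w) + a *: u.
    by rewrite -addrA -scalerDr [proj V w + u]addrC /u subrK.
  have Vt : V (v + a *: proj V w) by apply: subspD => //; apply: subspZ => //; exact: projL.
  rewrite innerDl innerZl (inner_sym0 (proj_orth cV w Vt)) add0r mulfK// addrK.
  exact: Vt.
set a := inner z u / inner u u => Vz.
exists a, (z - a *: u - a *: proj V w); split.
  by apply: subspB => //; apply: subspZ => //; exact: projL.
have -> : a *: w = a *: proj V w + a *: u by rewrite -scalerDr addrC /u subrK.
by rewrite addrA subrK subrK.
Qed.

Lemma csub_add_span V n (w : 'I_n -> H) : csubspace V ->
  csubspace [set z | exists v (a : 'I_n -> R[i]), V v /\ z = v + \sum_i a i *: w i].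
Proof.
elim: n w => [|n ih] w cV.
  suff -> : [set z | exists v (a : 'I_0 -> R[i]), V v /\ z = v + \sum_i a i *: w i] = V by [].
  rewrite eqEsubset; split=> [_ [v [a [Vv ->]]]|z Vz]; first by rewrite big_ord0 addr0.
  by exists z, (fun _ => 0); rewrite big_ord0 addr0.
have := csub_add_line (w ord0) (ih (fun i => w (lift ord0 i)) cV).
congr csubspace; rewrite eqEsubset; split=> z.
  move=> [b [_ [[v [a [Vv ->]]] ->]]].
  exists v, (fun i => if unlift ord0 i is Some j then a j else b); split=> //.
  rewrite big_ord_recl unlift_none -addrA [_ + b *: _]addrC; congr (_ + (_ + _)).
  by apply: eq_bigr => i _; rewrite liftK.
move=> [v [a [Vv ->]]]; exists (a ord0), (v + \sum_(i < n) a (lift ord0 i) *: w (lift ord0 i)).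
split; first by exists v, (fun i => a (lift ord0 i)).
by rewrite big_ord_recl -addrA [a ord0 *: _ + _]addrC.
Qed.

End semi_fredholm.

(** * Index zero and triangular block operators *)

Section index.
Context {R : realType} {H : hilbertType R}.
Implicit Types (x y z w : H) (A B : bounded_operator H) (L M : set H).

Lemma op_sum A n (a : 'I_n -> R[i]) (p : 'I_n -> H) :
  A (\sum_i a i *: p i) = \sum_i a i *: A (p i).
Proof. by rewrite linear_sum; apply: eq_bigr => i _; rewrite linearZ. Qed.

(** The image of L is the image of L `&` perp p, closed by the lower bound, plus
    the span of the finitely many A (p i). *)
Lemma left_sF_closed_range L A : csubspace L -> left_sF L A -> csubspace (A @` L).
Proof.
move=> cL [n [p [c [op Lp c0 bA]]]].
have := csub_add_span (fun i => A (p i))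
  (image_csub (csub_perp p cL) (fun x Lx => bA x (proj1 Lx) (proj2 Lx))).
congr csubspace; rewrite eqEsubset; split=> [_ [_ [a [[x [Lx _] <-] ->]]]|_ [x Lx <-]].
  exists (x + \sum_i a i *: p i); last by rewrite opD op_sum.
  by apply: subspD => //; [exact: (proj1 cL)|apply: subsp_sum => [|i]; [exact: (proj1 cL)|apply: subspZ => //; exact: (proj1 cL)]].
have dx := perp_decomposition (proj1 cL) op Lp Lx.
exists (A (x - \sum_i inner x (p i) *: p i)), (fun i => inner x (p i)).
by split; [exists (x - \sum_i inner x (p i) *: p i)|rewrite -op_sum -opD subrK].
Qed.

Lemma left_sF_surjective L A : csubspace L -> left_sF L A -> L `<=` adherent (A @` L) ->
  surjective_on L A.
Proof.
by move=> cL lA LA y /LA; case: (left_sF_closed_range cL lA) => _ h /h [x Lx <-]; exists x.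
Qed.

(** This is invariance of the index, for index zero. Let L0 be the part of L
    orthogonal to the p i. The images A' L0 and B L0 are so close that a vector
    of L orthogonal to A' L0 is determined by its component orthogonal to B L0,
    hence, as B is onto, by its n inner products with the q j. If A' is
    injective, the classes of the A' (p i) modulo A' L0 are independent, so the
    n by n matrix of their inner products with the q j is invertible, and the
    A' (p i) span L modulo A' L0. *)
Lemma fredholm_alternative_near L A B A' n (p : 'I_n -> H) (c eta : R) :
  csubspace L -> orthonormal_family p -> (forall i, L (p i)) -> 0 < c ->
  (forall x, L x -> perp p x -> nr x <= c * nr (A x)) ->
  maps L B -> injective_on L B -> surjective_on L B ->
  maps L A' -> 0 <= eta -> eta * c <= 8^-1 ->
  (forall x, L x -> nr (A x - B x) <= eta * nr x) ->
  (forall x, L x -> nr (A x - A' x) <= eta * nr x) ->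
  injective_on L A' -> surjective_on L A'.
Proof.
move=> cL op Lp c0 bA mB iB sB mA' e0 ec AB AA' iA'.
have [sL _] := cL.
pose L0 := L `&` perp p.
have cL0 : csubspace L0 := csub_perp p cL.
have bA0 x : L0 x -> nr x <= c * nr (A x) by move=> [Lx px]; exact: bA.
have bB : forall x, L0 x -> nr x <= c * 2 * nr (B x).
  by apply: (injective_perturb c0 bA0 (eta := eta)) => [|x [Lx _]]; [lra|exact: AB].
have bA' : forall x, L0 x -> nr x <= c * 2 * nr (A' x).
  by apply: (injective_perturb c0 bA0 (eta := eta)) => [|x [Lx _]]; [lra|exact: AA'].
pose RA := A' @` L0; pose RB := B @` L0.
have cRA : csubspace RA := image_csub cL0 bA'.
have cRB : csubspace RB := image_csub cL0 bB.
pose q j := B (p j) - proj RB (B (p j)).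
(* The inner products with the q j determine the component of w orthogonal to
   B L0, because B maps L onto L. If this component vanishes, w is in B L0,
   which is close to A' L0, and w is orthogonal to A' L0. *)
have key w : L w -> orth RA w -> (forall j, inner w (q j) = 0) -> w = 0.
  move=> Lw oA wq.
  pose z := w - proj RB w.
  have Lz : L z.
    apply: subspB => //; have [x [Lx _] <-] := projL cRB w; exact: mB.
  have [t Lt Bt] := sB _ Lz.
  have z0 : z = 0.
    apply: inner_xx0; rewrite -[X in inner _ X]Bt.
    rewrite -(subrK (\sum_i inner t (p i) *: p i) t) opD innerDr op_sum inner_sumr.
    rewrite (proj_orth cRB); last first.
      by exists (t - \sum_i inner t (p i) *: p i) => //; exact: perp_decomposition.
    rewrite add0r big1// => i _; rewrite innerZr /z innerBl proj_self// -innerBr.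
    by rewrite wq mulr0.
  have [x Lx Bx] := projL cRB w; rewrite -/RB in Bx.
  have wB : w = B x by rewrite Bx; apply/eqP; rewrite -subr_eq0 -/z z0.
  have ww : inner w w = inner w (B x - A' x).
    by rewrite innerBr -wB (oA (A' x)) ?subr0//; exists x.
  have dx : nr (B x - A' x) <= 2 * eta * nr x.
    have := nr_tri (A x) (B x) (A' x); rewrite (nrC (B x) (A x)).
    by have := AB _ (proj1 Lx); have := AA' _ (proj1 Lx); lra.
  have xw := bB _ Lx; rewrite -wB in xw.
  have := nr_inner w (B x - A' x); rewrite -ww inner_xx nrR ger0_norm ?exprn_ge0 ?nr_ge0//.
  move=> w2; apply: nr_eq0; apply/eqP; rewrite eq_le nr_ge0 andbT leNgt; apply/negP => w0.
  have : nr w * nr w <= nr w * (2 * eta * nr x).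
    by rewrite -expr2 (le_trans w2)// ler_pM2l.
  rewrite ler_pM2l// => w3.
  have : 2 * eta * nr x <= 2 * eta * (c * 2 * nr w) by rewrite ler_wpM2l// mulr_ge0.
  have : eta * c * nr w <= 8^-1 * nr w by rewrite ler_wpM2r// ltW.
  by lra.
pose W u := u - proj RA u.
have LW u : L u -> L (W u).
  by move=> Lu; apply: subspB => //; have [x [Lx _] <-] := projL cRA u; exact: mA'.
have oW u : orth RA (W u) by exact: (proj_orth cRA).
have Wlin a u v : W (a *: u + v) = a *: W u + W v.
  by rewrite /W opD opZ opprD addrACA -scalerBr.
have W0 : W 0 = 0 by rewrite /W op0 subrr.
have WE u : W u = 0 -> RA u.
  by move/eqP; rewrite subr_eq0 => /eqP ->; exact: projL.
have WA (a : 'I_n -> R[i]) : W (A' (\sum_i a i *: p i)) = \sum_i a i *: W (A' (p i)).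
  rewrite op_sum; apply: (big_ind2 (fun u v => W u = v)) => //.
    by move=> u u' v v' <- <-; rewrite -[u in LHS]scale1r Wlin scale1r.
  by move=> i _; rewrite -[_ *: A' _]addr0 Wlin W0 addr0.
have Lsum (a : 'I_n -> R[i]) : L (\sum_i a i *: p i).
  by apply: subsp_sum => // i; exact: subspZ.
pose M : 'M[R[i]]_n := \matrix_(i, j) inner (W (A' (p i))) (q j).
have ME (a : 'rV_n) j : (a *m M) 0 j = inner (W (A' (\sum_i a 0 i *: p i))) (q j).
  by rewrite WA inner_suml mxE; apply: eq_bigr => i _; rewrite mxE innerZl.
(* A vector of the left kernel gives a combination of the p i that A' maps into
   A' L0; by injectivity it is in L0, and being orthogonal to L0 it is zero. *)
have freeM : row_free M.
  apply: inj_row_free => a aM; pose v := \sum_i a 0 i *: p i.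
  have Wv : W (A' v) = 0.
    by apply: key; [exact/LW/mA'/Lsum|exact: oW|move=> j; rewrite -ME aM mxE].
  have [x [Lx px] A'x] := WE _ Wv.
  have xv : v = x.
    apply/eqP; rewrite -subr_eq0; apply/eqP/iA'; first by apply: subspB => //; exact: Lsum.
    by rewrite opB A'x subrr.
  apply/rowP => j; rewrite mxE -(px j) -xv inner_suml (bigD1 j)//= innerZl op eqxx mulr1.
  by rewrite big1 ?addr0// => i ij; rewrite innerZl op (negbTE ij) mulr0.
move=> y Ly.
pose phi : 'rV[R[i]]_n := \row_j inner (W y) (q j).
pose a := phi *m invmx M; pose v := \sum_i a 0 i *: p i.
have aM : a *m M = phi by rewrite mulmxKV// -row_free_unit.
have Wyv : W (y - A' v) = 0.
  apply: key; [apply: LW; apply: subspB => //; exact/mA'/Lsum|exact: oW|move=> j].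
  have -> : W (y - A' v) = W y - W (A' v).
    by rewrite addrC -scaleN1r Wlin scaleN1r addrC.
  by rewrite innerBl -ME aM mxE subrr.
have [x [Lx _] A'x] := WE _ Wyv.
exists (x + v); first by apply: subspD => //; exact: Lsum.
by rewrite opD A'x subrK.
Qed.

Section block.
Context (L M : set H) (A B : bounded_operator H).
Context (sL : lsubspace L) (ML : M `<=` L).
Context (AB : forall x, L x -> M (B x - A x)).
Context (iB : injective_on M B) (sB : surjective_on M B).

(** A and B differ by an operator into M, so a solution for A is corrected to a
    solution for B inside M. *)
Lemma block_surjective : surjective_on L A -> surjective_on L B.
Proof.
move=> sA y /sA[x Lx Ax]; have [m Mm Bm] := sB (AB Lx).
exists (x - m); first by apply: subspB => //; exact: ML.
by rewrite opB Bm opprB addrC subrK.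
Qed.

Lemma block_injective : lsubspace M -> surjective_on M A ->
  injective_on L A -> injective_on L B.
Proof.
move=> sM sMA iA x Lx Bx; apply: iB => //.
have := AB Lx; rewrite Bx sub0r => /sMA[m Mm Am].
suff /eqP : x + m = 0 by rewrite addr_eq0 => /eqP ->; exact: subspN.
by apply: iA; [apply: subspD => //; exact: ML|rewrite opD Am subrr].
Qed.

End block.

End index.

(** * Operators on the closed span of an orthonormal sequence *)

Section orthonormal_sequence.
Context {R : realType} {H : hilbertType R}.
Implicit Types (x y z : H) (A B : bounded_operator H) (L M : set H).
Context (e : nat -> H) (eo : forall i j, inner (e i) (e j) = (i == j)%:R).

(** As a double orthogonal complement it is closed by construction, and its
    elements are visibly determined by their coordinates. *)
Definition closed_span : set H := orth (orth (range e)).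

Lemma csub_closed_span : csubspace closed_span. Proof. exact: csub_orth. Qed.

Lemma closed_span_e k : closed_span (e k).
Proof. by move=> z oz; apply/inner_sym0/oz; exists k. Qed.

Lemma closed_span_sub L : csubspace L -> (forall k, L (e k)) -> closed_span `<=` L.
Proof.
move=> cL Le x Mx; apply: (orthK cL) => z oz; apply: Mx => _ [k _ <-].
by apply: oz.
Qed.

Lemma coord_eq0 x : closed_span x -> (forall k, inner x (e k) = 0) -> x = 0.
Proof. by move=> Mx xe; apply: inner_xx0; apply: Mx => _ [k _ <-]. Qed.

Lemma coord_ext x y : closed_span x -> closed_span y ->
  (forall k, inner x (e k) = inner y (e k)) -> x = y.
Proof.
move=> Mx My xy; apply/eqP; rewrite -subr_eq0; apply/eqP/coord_eq0.
  exact: (subspB (proj1 csub_closed_span) Mx My).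
by move=> k; rewrite innerBl xy subrr.
Qed.

Definition partial (c : nat -> R[i]) n : H := \sum_(i < n) c i *: e i.

Lemma partial_coord c n k : inner (partial c n) (e k) = if (k < n)%N then c k else 0.
Proof.
rewrite inner_suml; case: ltnP => kn.
  rewrite (bigD1 (Ordinal kn))//= innerZl eo eqxx mulr1 big1 ?addr0// => i.
  by move=> /eqP ik; rewrite innerZl eo; case: eqP => [ki|]; rewrite ?mulr0//; case: ik; apply/val_inj.
rewrite big1// => i _; rewrite innerZl eo (_ : _ == _ = false) ?mulr0//.
by apply/negbTE; rewrite neq_ltn (leq_trans (ltn_ord i) kn).
Qed.

Lemma partial_norm c m n : (m <= n)%N ->
  nr (partial c n - partial c m) ^+ 2 = \sum_(i < n) nr (c i) ^+ 2 - \sum_(i < m) nr (c i) ^+ 2.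
Proof.
elim: n => [|n ih].
  by rewrite leqn0 => /eqP ->; rewrite !subrr nr0 expr0n.
rewrite leq_eqVlt => /orP[/eqP ->|]; first by rewrite !subrr nr0 expr0n.
rewrite ltnS => mn; rewrite /partial !big_ord_recr /= -/(partial c n) -/(partial c m).
rewrite addrAC pythagoras; last first.
  by rewrite innerZr innerBl !partial_coord ltnn ltnNge mn/= subrr mulr0.
rewrite ih// nrZ exprMn [in X in _ * X](_ : nr (e n) ^+ 2 = 1) ?mulr1 1?addrAC//.
by apply: complexI; rewrite -inner_xx eo eqxx.
Qed.

Lemma bessel x n : \sum_(i < n) nr (inner x (e i)) ^+ 2 <= nr x ^+ 2.
Proof.
pose y := partial (fun i => inner x (e i)) n.
have <- : nr y ^+ 2 = \sum_(i < n) nr (inner x (e i)) ^+ 2.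
  by have := partial_norm (fun i => inner x (e i)) (leq0n n); rewrite /partial !big_ord0 !subr0.
have xy : inner y (x - y) = 0.
  rewrite [in X in inner X _]/y inner_suml big1// => i _; rewrite innerZl.
  by rewrite (inner_sym0 (x := x - y)) ?mulr0// innerBl partial_coord ltn_ord subrr.
by rewrite ler_pXn2r ?nnegrE ?nr_ge0//; have := pythagoras_le xy; rewrite addrC subrK.
Qed.

Lemma riesz_fischer (c : nat -> R[i]) (C : R) : 0 <= C ->
  (forall n, \sum_(i < n) nr (c i) ^+ 2 <= C ^+ 2) ->
  exists x, [/\ closed_span x, forall k, inner x (e k) = c k & nr x <= C].
Proof.
move=> C0 cC; pose S n : R := \sum_(i < n) nr (c i) ^+ 2.
have Sm m n : (m <= n)%N -> S m <= S n.
  by move=> mn; rewrite -subr_ge0 -partial_norm// exprn_ge0// nr_ge0.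
pose D := range S.
have hD : has_sup D.
  by split; [exists (S 0%N), 0%N|exists (C ^+ 2) => _ [n _ <-]; exact: cC].
pose s := sup D.
have Ss n : S n <= s by apply: ub_le_sup; [case: hD|exists n].
pose b n := Num.sqrt (s - S n).
have b0 n : 0 <= b n by exact: sqrtr_ge0.
have bm m n : (m <= n)%N -> b n <= b m.
  by move=> mn; rewrite ler_wsqrtr// lerD2l lerN2 Sm.
have bs t : 0 < t -> exists n, b n < t.
  move=> t0; have t2 : 0 < t ^+ 2 by rewrite exprn_gt0.
  have [_ [n _ <-] sn] := sup_adherent t2 hD; exists n.
  rewrite -(@ltr_pXn2r _ 2)// ?nnegrE ?(ltW t0)// sqr_sqrtr ?subr_ge0 ?Ss//.
  by rewrite -/s in sn; lra.
have [x xP] : exists x, forall n, nr (x - partial c n) <= b n.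
  apply: cauchy_sequence_limit bs => m n mn.
  rewrite -(@ler_pXn2r _ 2) ?nnegrE ?nr_ge0// sqr_sqrtr ?subr_ge0 ?Ss//.
  by rewrite partial_norm// lerD2r; exact: Ss.
have small t : (forall n, t <= b n) -> t <= 0.
  move=> tb; apply/ler_addgt0Pr => u /bs[n nu].
  by rewrite add0r (le_trans (tb n))// ltW.
exists x; split.
- apply: (proj2 csub_closed_span) => t /bs[n nt]; exists (partial c n).
    apply: subsp_sum => [|i]; first exact: (proj1 csub_closed_span).
    exact: (subspZ _ (proj1 csub_closed_span) (closed_span_e i)).
  exact: le_lt_trans (xP n) nt.
- move=> k; apply/eqP; rewrite -subr_eq0; apply/eqP/nr_eq0/eqP; rewrite eq_le nr_ge0 andbT.
  apply: small => n; apply: le_trans (bm _ _ (leq_addr k.+1 n)).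
  have -> : c k = inner (partial c (n + k.+1)) (e k) by rewrite partial_coord addnS ltnS leq_addl.
  rewrite -innerBl (le_trans (nr_inner _ _))// (_ : nr (e k) = 1) ?mulr1//.
  apply/eqP; rewrite -(@eqrXn2 _ 2)// ?nr_ge0// expr1n; apply/eqP/complexI.
  by rewrite -inner_xx eo eqxx.
- rewrite -subr_le0; apply: small => n; rewrite lerBlDr.
  have := nr_tri (partial c n) x 0; rewrite !subr0; have := xP n.
  suff : nr (partial c n) <= C by lra.
  rewrite -(@ler_pXn2r _ 2) ?nnegrE ?nr_ge0//.
  by have := partial_norm c (leq0n n); rewrite {2}/partial !big_ord0 !subr0 => ->.
Qed.

(** Backward shift by m places with weights a; for m = 0 this is a diagonal
    operator. Identities between such operators are checked on coordinates. *)
Lemma weighted_shift (a : nat -> R[i]) (m : nat) (C : R) : 0 <= C ->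
  (forall k, nr (a k) <= C) ->
  exists B : bounded_operator H, [/\ forall x, closed_span (B x),
    forall x k, inner (B x) (e k) = a k * inner x (e (k + m)%N) &
    forall x, nr (B x) <= C * nr x].
Proof.
move=> C0 aC.
have fE x : exists y, [/\ closed_span y,
    forall k, inner y (e k) = a k * inner x (e (k + m)%N) & nr y <= C * nr x].
  apply: riesz_fischer => [|n]; first by rewrite mulr_ge0// nr_ge0.
  rewrite exprMn; apply: (@le_trans _ _ (C ^+ 2 * \sum_(i < n) nr (inner x (e (i + m)%N)) ^+ 2)).
    rewrite mulr_sumr; apply: ler_sum => i _; rewrite nrM exprMn ler_wpM2r ?exprn_ge0 ?nr_ge0//.
    by rewrite ler_pXn2r ?nnegrE ?nr_ge0.
  rewrite ler_wpM2l ?exprn_ge0//; apply: le_trans (bessel x (m + n)).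
  rewrite big_split_ord /= -[leLHS]add0r lerD//.
    by apply: sumr_ge0 => i _; rewrite exprn_ge0// nr_ge0.
  by apply: ler_sum => i _; rewrite addnC.
have [f fP] := choice fE.
have [||B BE] := @build_bop _ _ f C.
- move=> b x y; apply: coord_ext; first by case: (fP (b *: x + y)).
    case: csub_closed_span => -[_ l] _; apply: l; first by case: (fP x).
    by case: (fP y).
  move=> k; rewrite inner_linearl; have [_ -> _] := fP (b *: x + y).
  by have [_ -> _] := fP x; have [_ -> _] := fP y; rewrite inner_linearl mulrDr mulrCA.
- by move=> x; case: (fP x).
by exists B; split=> [x|x k|x]; rewrite BE; case: (fP x).
Qed.

(** An operator with prescribed small values on the orthonormal sequence, zero
    on its complement. *)
Lemma small_series_operator (g : nat -> H) (d : R) : 0 <= d ->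
  (forall k, nr (g k) <= d * 2^-1 ^+ k) ->
  exists K : bounded_operator H, [/\ forall k, K (e k) = g k,
    forall x, nr (K x) <= d * 2 * nr x,
    forall V, csubspace V -> (forall k, V (g k)) -> forall x, V (K x) &
    forall x, (forall k, inner x (e k) = 0) -> K x = 0].
Proof.
move=> d0 gd.
pose X x n := \sum_(i < n) inner x (e i) *: g i.
have e1 k : nr (e k) = 1.
  apply/eqP; rewrite -(@eqrXn2 _ 2)// ?nr_ge0// expr1n; apply/eqP/complexI.
  by rewrite -inner_xx eo eqxx.
have q0 : 0 <= 2^-1 :> R by lra.
have q1 : 2^-1 < 1 :> R by lra.
have fE x : exists y, forall n, nr (y - X x n) <= d * nr x / (1 - 2^-1) * 2^-1 ^+ n.
  apply: geometric_limit => //; first by rewrite mulr_ge0// nr_ge0.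
  move=> n; have -> : X x n.+1 - X x n = inner x (e n) *: g n.
    by rewrite /X big_ord_recr /= [LHS]addrC addKr.
  rewrite nrZ; have := nr_inner x (e n); rewrite e1 mulr1 => h.
  apply: (@le_trans _ _ (nr x * (d * 2^-1 ^+ n))); last by lra.
  by apply: ler_pM; rewrite ?nr_ge0.
have [f fP] := choice fE.
have fP' x n : nr (f x - X x n) <= d * 2 * nr x * 2^-1 ^+ n.
  have := fP x n; have -> : d * nr x / (1 - 2^-1) = d * 2 * nr x by field.
  by [].
have lim0 y (C : R) : 0 <= C -> (forall n, nr y <= C * 2^-1 ^+ n) -> y = 0.
  move=> C0 h; apply: nr_eq0; apply/eqP; rewrite eq_le nr_ge0 andbT.
  apply/ler_addgt0Pr => t t0; rewrite add0r.
  have C1 : 0 < C + 1 by lra.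
  have [|n] := exprn_small q0 q1 (e := t / (C + 1)); first by rewrite divr_gt0.
  rewrite ltr_pdivlMr// => nt; apply: le_trans (h n) _.
  by have := exprn_ge0 n q0; lra.
have XL b x y n : X (b *: x + y) n = b *: X x n + X y n.
  rewrite /X scaler_sumr -big_split; apply: eq_bigr => i _ /=.
  by rewrite inner_linearl scalerDl scalerA.
have [||K KE] := @build_bop _ _ f (d * 2).
- move=> b x y; apply/eqP; rewrite -subr_eq0; apply/eqP.
  apply: (lim0 _ (d * 2 * nr (b *: x + y) + nr b * (d * 2 * nr x) + d * 2 * nr y)).
    by rewrite !addr_ge0 ?mulr_ge0 ?nr_ge0.
  move=> n.
  have -> : f (b *: x + y) - (b *: f x + f y) =
      (f (b *: x + y) - X (b *: x + y) n) - (b *: (f x - X x n) + (f y - X y n)).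
    by rewrite XL scalerBr addrACA -opprD opprB addrA subrK.
  rewrite (le_trans (nrB _ _))// !mulrDl -addrA lerD//.
  rewrite (le_trans (nrD _ _))// lerD// nrZ -mulrA ler_wpM2l ?nr_ge0//.
- by move=> x; have := fP' x 0%N; rewrite /X big_ord0 subr0 expr0 mulr1.
have Xsmall x t : 0 < t -> exists n, nr (f x - X x n) < t.
  move=> t0; have C1 : 0 < d * 2 * nr x + 1 by have := mulr_ge0 d0 (nr_ge0 x); lra.
  have [|n] := exprn_small q0 q1 (e := t / (d * 2 * nr x + 1)); first by rewrite divr_gt0.
  rewrite ltr_pdivlMr// => nt; exists n; apply: le_lt_trans (fP' x n) _.
  by have := exprn_ge0 n q0; lra.
exists K; split.
- move=> k; rewrite KE; apply/eqP; rewrite -subr_eq0; apply/eqP.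
  apply: (lim0 _ (d * 2)) => [|n]; first by lra.
  have -> : g k = X (e k) (n + k.+1)%N.
    rewrite /X (bigD1 (Ordinal (leq_addl n k.+1)))//= eo eqxx scale1r big1 ?addr0// => i.
    move=> /eqP ik; rewrite eo; case: eqP => [ki|]; rewrite ?scale0r//.
    by case: ik; apply/val_inj.
  apply: le_trans (fP' _ _) _; rewrite e1 mulr1 ler_wpM2l//; first by lra.
  by rewrite ler_wiXn2l ?leq_addr// ltW.
- by move=> x; rewrite KE; have := fP' x 0%N; rewrite /X big_ord0 subr0 expr0 mulr1.
- move=> V [sV clV] Vg x; rewrite KE; apply: clV => t /(Xsmall x)[n nt].
  by exists (X x n) => //; apply: subsp_sum => // i; exact: subspZ.
- move=> x xe; rewrite KE; apply: (lim0 _ (d * 2 * nr x)) => [|n].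
    by rewrite !mulr_ge0 ?nr_ge0.
  have := fP' x n; rewrite /X big1 ?subr0// => i _.
  by rewrite xe scale0r.
Qed.

End orthonormal_sequence.

(** * Approximate eigenvectors and shift weights *)

Section approximate_eigenvectors.
Context {R : realType} {H : hilbertType R}.
Implicit Types (x y z : H) (A B S : bounded_operator H) (L M : set H).

Lemma approximate_kernel_vector L A n (p : 'I_n -> H) (d : R) : csubspace L -> ~ left_sF L A ->
  orthonormal_family p -> (forall i, L (p i)) -> 0 < d ->
  exists x, [/\ L x, perp p x, nr x = 1 & nr (A x) <= d].
Proof.
move=> [sL _] nA op Lp d0; apply: contrapT => nx; apply: nA.
exists n, p, d^-1; split=> //; first by rewrite invr_gt0.
move=> x Lx px; rewrite leNgt; apply/negP => h; apply: nx.
have x0 : 0 < nr x by apply: le_lt_trans h; rewrite mulr_ge0 ?nr_ge0// invr_ge0 ltW.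
exists ((nr x)^-1%:C *: x); split; first exact: subspZ.
- by move=> i; rewrite innerZl px mulr0.
- by rewrite nrZ nrR ger0_norm ?invr_ge0 ?nr_ge0// mulVf// gt_eqF.
rewrite opZ nrZ nrR ger0_norm ?invr_ge0 ?nr_ge0// ler_pdivrMl//.
by move: h; rewrite ltr_pdivrMl// mulrC => /ltW.
Qed.

(** Choose e k orthogonal to the vectors already chosen: as the span of these is
    finite dimensional, it cannot account for the failure of the lower bound. *)
Lemma approximate_eigenvectors L S (mu : nat -> R[i]) (d : R) : csubspace L ->
  (forall k, ~ left_sF L (S - mu k *: id_bop H)) -> 0 < d ->
  exists e : nat -> H, [/\ forall i j, inner (e i) (e j) = (i == j)%:R,
    forall k, L (e k) & forall k, nr (S (e k) - mu k *: e k) <= d * 2^-1 ^+ k].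
Proof.
move=> cL nS d0.
pose good (s : seq H) x := [/\ L x, forall i, (i < size s)%N -> inner x s`_i = 0,
  nr x = 1 & nr (S x - mu (size s) *: x) <= d * 2^-1 ^+ size s].
have gE (s : seq H) : exists x,
    (forall i, (i < size s)%N -> L s`_i) ->
    (forall i j, (i < size s)%N -> (j < size s)%N -> inner s`_i s`_j = (i == j)%:R) ->
    good s x.
  have [[h1 h2]|nh] := pselect ((forall i, (i < size s)%N -> L s`_i) /\
    (forall i j, (i < size s)%N -> (j < size s)%N -> inner s`_i s`_j = (i == j)%:R)); last first.
    by exists 0 => h1 h2; case: nh.
  have [|||x [Lx px x1 Sx]] := @approximate_kernel_vector L _ (size s) (fun i => s`_i) (d * 2^-1 ^+ size s) cL (nS (size s)).
  - by move=> i j; rewrite h2.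
  - move=> i; exact: h1.
  - by rewrite mulr_gt0// exprn_gt0//; lra.
  - by exists x => _ _; split=> // i si; have := px (Ordinal si).
have [g gP] := choice gE.
pose st := fix st n := if n is k.+1 then rcons (st k) (g (st k)) else [::].
pose e k := g (st k).
have st_size k : size (st k) = k by elim: k => //= k ih; rewrite size_rcons ih.
have st_nth k i : (i < k)%N -> (st k)`_i = e i.
  elim: k => // k ih; rewrite ltnS leq_eqVlt /= nth_rcons st_size => /orP[/eqP ->|ik].
    by rewrite ltnn eqxx.
  by rewrite ik ih.
have eP k : good (st k) (e k).
  elim/ltn_ind: k => k ih; apply: gP => [i|i j]; rewrite st_size.
    by move=> ik; rewrite st_nth//; case: (ih _ ik).
  have lt a b : (b < a)%N -> (a < k)%N -> inner (e a) (e b) = 0.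
    move=> ba ak; have [_ h _ _] := ih _ ak.
    by have := h b; rewrite st_size st_nth// => ->.
  move=> ik jk; rewrite !st_nth//; have [ij|ji|->] := ltngtP i j.
  - by apply: inner_sym0; rewrite lt.
  - by rewrite lt.
  - by have [_ _ e1 _] := ih _ jk; rewrite inner_xx e1 expr1n.
have lt a b : (b < a)%N -> inner (e a) (e b) = 0.
  by move=> ba; have [_ h _ _] := eP a; have := h b; rewrite st_size st_nth// => ->.
exists e; split=> [i j|k|k].
- have [ij|ji|->] := ltngtP i j.
  + by apply: inner_sym0; rewrite lt.
  + by rewrite lt.
  + by have [_ _ e1 _] := eP j; rewrite inner_xx e1 expr1n.
- by case: (eP k).
- by have [_ _ _] := eP k; rewrite st_size.
Qed.

End approximate_eigenvectors.

Section weights.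
Context {R : realType}.

(** The shift by m places will have the weights h (k + m) / h k. A product of n
    consecutive weights is at most (n + 1) ^ 2, so the shift has spectral radius
    at most 1; the coordinates of its eigenvectors are z ^ (k / m) / h k, and these are
    square summable on the whole closed disc |z| <= 1. *)
Lemma weight_sequence (m : nat) : (0 < m)%N -> exists h : nat -> R,
  [/\ forall k, 1 <= h k, forall k n, h (k + n * m)%N <= n.+1%:R ^+ 2 * h k,
      forall i, (i < m)%N -> h i = 1 &
      exists2 C : R, 0 <= C & forall N, \sum_(k < N) (h k)^-1 ^+ 2 <= C ^+ 2].
Proof.
move=> m0; exists (fun k => ((k %/ m).+1)%:R ^+ 2).
have h1 k : 1 <= ((k %/ m).+1)%:R ^+ 2 :> R by rewrite exprn_ege1// ler1n.
split=> //.
- move=> k n; rewrite -exprMn ler_pXn2r ?nnegrE ?mulr_ge0//.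
  rewrite -natrM ler_nat addnC divnMDl//.
  by rewrite mulSn mulnS addSn ltnS addnA [(k %/ m + n)%N]addnC leq_addr.
- by move=> i im; rewrite divn_small// expr1n.
exists (2 * m%:R); first by rewrite mulr_ge0.
move=> N; apply: (@le_trans _ _ (m%:R ^+ 2 * (2 - 2 * N.+1%:R^-1))); last first.
  have : 0 <= N.+1%:R^-1 :> R by rewrite invr_ge0.
  have : 0 <= m%:R :> R by [].
  set u := N.+1%:R^-1; set v := m%:R => v0 u0.
  rewrite exprMn; have : 0 <= v ^+ 2 by rewrite exprn_ge0.
  by nra.
elim: N => [|N ih]; first by rewrite big_ord0 invr1 mulr1 subrr mulr0.
rewrite big_ord_recr /=; apply: le_trans (lerD ih (lexx _)) _.
have : ((N %/ m).+1%:R ^+ 2)^-1 ^+ 2 <= m%:R ^+ 2 / N.+1%:R ^+ 2 :> R.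
  apply: (@le_trans _ _ (((N %/ m).+1)%:R ^+ 2)^-1).
    by rewrite expr2 ler_piMl// ?invr_ge0 ?exprn_ge0// invf_le1// exprn_gt0.
  rewrite ler_pdivlMr ?exprn_gt0// mulrC ler_pdivrMr ?exprn_gt0// -exprMn.
  rewrite ler_pXn2r ?nnegrE ?mulr_ge0// -natrM ler_nat mulnC.
  exact: ltn_ceil.
move=> h; rewrite (le_trans (lerD (lexx _) h))// -mulrDr ler_wpM2l ?exprn_ge0//.
rewrite -[N.+2%:R]natr1; have : 1 <= N.+1%:R :> R by rewrite ler1n.
set u := N.+1%:R => u1; rewrite -subr_ge0.
have -> : 2 - 2 * (u + 1)^-1 - (2 - 2 * u^-1 + (u ^+ 2)^-1) = (u - 1) / (u ^+ 2 * (u + 1)).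
  by field; rewrite gt_eqF/= ?gt_eqF//; lra.
by rewrite divr_ge0 ?mulr_ge0 ?exprn_ge0//; lra.
Qed.

End weights.

(** * Weighted shifts that fill closed discs with eigenvalues *)

Section disc.
Context {R : realType} {H : hilbertType R}.
Implicit Types (x y z : H) (A B S K E : bounded_operator H) (L M : set H).

Lemma separated_from_seq (F : seq R[i]) (lam : R[i]) (eps : R) :
  (forall mu : R[i], mu \in F -> eps < nr (lam - mu)) ->
  exists2 rho, eps < rho & forall mu : R[i], mu \in F -> rho <= nr (lam - mu).
Proof.
elim: F => [|mu F ih] h; first by exists (eps + 1); [lra|].
have [nu nuF|rho er rF] := ih; first by apply: h; rewrite inE nuF orbT.
exists (Num.min rho (nr (lam - mu))); first by rewrite lt_min er h// mem_head.
move=> nu; rewrite inE ge_min => /orP[/eqP ->|/rF ->//]; by rewrite lexx orbT.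
Qed.

Section shift_model.
Context (e : nat -> H) (eo : forall i j, inner (e i) (e j) = (i == j)%:R).
Context (m : nat) (mu : nat -> R[i]) (eps : R) (h : nat -> R).
Context (m0 : (0 < m)%N) (muS : forall k, mu (k + m)%N = mu k) (eps0 : 0 < eps).
Context (h1 : forall k, 1 <= h k).
Context (hB : forall k n, h (k + n * m)%N <= n.+1%:R ^+ 2 * h k).
Context (A E : bounded_operator H).
Local Notation M := (closed_span e).
Context (MA : maps M A) (ME : forall x, M (E x)).
Context (Ac : forall x k, M x -> inner (A x) (e k) = mu k * inner x (e k)).
Context (Ec : forall x k,
  inner (E x) (e k) = (eps * (h (k + m)%N / h k))%:C * inner x (e (k + m)%N)).

Let h0 k : 0 < h k. Proof. exact: lt_le_trans (h1 k). Qed.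
Let hn0 k : (h k)%:C != 0 :> R[i].
Proof. by rewrite -[0]/(0%:C) (inj_eq (@complexI R)) gt_eqF. Qed.
Let sM : lsubspace M. Proof. exact: (proj1 (csub_closed_span e)). Qed.

Let shiftE B (lam : R[i]) x : (B - lam *: id_bop H) x = B x - lam *: x. Proof. by []. Qed.

Lemma diagonal_injective (lam : R[i]) : (forall k, mu k != lam) ->
  injective_on M (A - lam *: id_bop H).
Proof.
move=> ml x Mx; rewrite shiftE => Ax; apply: (coord_eq0 Mx) => k.
have : inner (A x - lam *: x) (e k) = 0 by rewrite Ax inner0l.
rewrite innerBl innerZl Ac// -mulrBl => /eqP; rewrite mulf_eq0 subr_eq0.
by rewrite (negbTE (ml k)) => /eqP.
Qed.

(** With X the shift with weights - eps (h (k + m) / h k) / (mu k - lam), the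
    equation (A + E - lam) x = y on M reads x - X x = Q y. Some power X ^ n has
    norm less than 1, so z - X ^ n z = Q y has a solution z, and the sum of the
    X ^ j z for j < n is the required x. *)
Lemma shift_surjective (lam : R[i]) (rho : R) : eps < rho -> (forall k, rho <= nr (lam - mu k)) ->
  surjective_on M (A + E - lam *: id_bop H).
Proof.
move=> er rl.
have rho0 : 0 < rho by exact: lt_trans er.
have dn k : mu k - lam != 0.
  by apply/eqP => ml; have := rl k; rewrite nrC ml nr0 leNgt rho0.
pose th := eps / rho.
have th0 : 0 <= th by rewrite divr_ge0 ?ltW.
have th1 : th < 1 by rewrite ltr_pdivrMr// mul1r.
pose c k : R[i] := - (eps%:C / (mu k - lam)).
have cS k j : c (k + j * m)%N = c k.
  rewrite /c; congr (- (_ / (_ - _))); elim: j => [|j ih]; first by rewrite addn0.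
  by rewrite mulSn addnCA addnC muS.
have cth k : nr (c k) <= th.
  rewrite nrN nrM nrV nrR gtr0_norm// ler_pM2l// lef_pV2 ?posrE//.
    by rewrite nrC.
  by apply: nr_gt0; exact: dn.
pose a j k : R[i] := c k ^+ j * (h (k + j * m)%N / h k)%:C.
have aB j k : nr (a j k) <= th ^+ j * j.+1%:R ^+ 2.
  rewrite nrM nrX nrR ger0_norm; last by rewrite divr_ge0 ?ltW.
  apply: ler_pM; rewrite ?exprn_ge0 ?nr_ge0 ?divr_ge0 ?(ltW (h0 _))//.
    by rewrite lerXn2r ?nnegrE ?nr_ge0.
  by rewrite ler_pdivrMr.
have [n nq] := exprn_sqr_small th0 th1.
set q := th ^+ n * _ in nq.
have q0 : 0 <= q by rewrite mulr_ge0 ?exprn_ge0.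
have [X [XM Xc _]] : exists X : bounded_operator H, [/\ forall x, M (X x),
    forall x k, inner (X x) (e k) = a 1%N k * inner x (e (k + m)%N) &
    forall x, nr (X x) <= th ^+ 1 * 2%:R ^+ 2 * nr x].
  by apply: (weighted_shift eo) => [|k]; [rewrite mulr_ge0 ?exprn_ge0|exact: aB].
have [Y [YM Yc YB]] : exists Y : bounded_operator H, [/\ forall x, M (Y x),
    forall x k, inner (Y x) (e k) = a n k * inner x (e (k + n * m)%N) &
    forall x, nr (Y x) <= q * nr x].
  by apply: (weighted_shift eo) => [//|k]; exact: aB.
have [Q [QM Qc _]] : exists Q : bounded_operator H, [/\ forall x, M (Q x),
    forall x k, inner (Q x) (e k) = (mu k - lam)^-1 * inner x (e (k + 0)%N) &
    forall x, nr (Q x) <= rho^-1 * nr x].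
  apply: (weighted_shift eo) => [|k]; first by rewrite invr_ge0 ltW.
  by rewrite nrV lef_pV2 ?posrE ?nr_gt0// nrC.
have iterP j z : M z -> M (iter j X z) /\
    forall k, inner (iter j X z) (e k) = a j k * inner z (e (k + j * m)%N).
  move=> Mz; elim: j => [|j [ihM ihc]].
    split=> // k; rewrite /a expr0 addn0 mul1r divff ?mul1r//.
    by rewrite gt_eqF.
  split=> [|k]; first exact: XM.
  rewrite /= Xc ihc /a mul1n expr1 (_ : (k + j.+1 * m = k + m + j * m)%N); last first.
    by rewrite mulSn addnA.
  have -> : c (k + m)%N = c k by rewrite -[m in LHS]mul1n cS.
  rewrite exprS !rmorphM /= !fmorphV /=.
  by have := hn0 k; have := hn0 (k + m)%N => hkm hk; field; rewrite hk hkm.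
have solY : solves M (id_bop H - Y) (1 / (1 - q)).
  apply: (approximate_solution (csub_closed_span e)) => // [x Mx|y My].
    by apply: (subspB sM Mx); exact: YM.
  exists y; rewrite mul1r; split=> //.
  by have -> : y - (id_bop H - Y) y = Y y by rewrite opprB addrC subrK.
move=> y My; have [z [Mz zY _]] := solY _ (QM y).
pose x := \sum_(j < n) iter j X z.
have Mx : M x by apply: subsp_sum => [|j]; [exact: sM|case: (iterP j z Mz)].
exists x => //.
have xX : x - X x = Q y.
  have -> : x - X x = z - iter n X z.
    rewrite /x; elim: n {nq q q0 Y YM Yc YB solY zY x Mx} => [|n ih].
      by rewrite big_ord0 op0 /= !subrr.
    by rewrite big_ord_recr /= opD opprD addrACA ih addrA subrK.
  rewrite -zY -[RHS]/(z - Y z); congr (_ - _).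
  have [Mi ci] := iterP n z Mz.
  by apply: (coord_ext Mi (YM z)) => k; rewrite ci Yc.
apply: coord_ext; [|exact: My|].
  rewrite shiftE bopD; apply: (subspB sM); last exact: (subspZ _ sM).
  by apply: (subspD sM); [exact: MA|exact: ME].
move=> k; rewrite shiftE bopD innerBl innerDl innerZl Ac// Ec.
have : inner (x - X x) (e k) = inner (Q y) (e k) by rewrite xX.
rewrite innerBl Xc Qc addn0 /a mul1n expr1 /c => xyk.
have -> : inner y (e k) = (mu k - lam) * ((mu k - lam)^-1 * inner y (e k)).
  by rewrite mulrA divff ?mul1r.
rewrite -xyk.
rewrite !rmorphM /= fmorphV; have := dn k; have := hn0 k => hk dk.
by field; rewrite hk dk.
Qed.

Lemma shift_eigenvector (lam : R[i]) i (C : R) : (i < m)%N -> (forall j, (j < m)%N -> h j = 1) ->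
  0 <= C -> (forall N, \sum_(k < N) (h k)^-1 ^+ 2 <= C ^+ 2) ->
  nr (lam - mu i) <= eps ->
  exists x, [/\ M x, x <> 0 & (A + E - lam *: id_bop H) x = 0].
Proof.
move=> im hm C0 hC le.
pose z : R[i] := (lam - mu i) / eps%:C.
have z1 : nr z <= 1 by rewrite nrM nrV nrR gtr0_norm// ler_pdivrMr// mul1r.
pose c k : R[i] := if (k %% m == i)%N then z ^+ (k %/ m)%N / (h k)%:C else 0.
have [x [Mx xc _]] : exists x, [/\ M x, forall k, inner x (e k) = c k & nr x <= C].
  apply: riesz_fischer => // N; apply: le_trans (hC N); apply: ler_sum => k _.
  rewrite ler_pXn2r ?nnegrE ?nr_ge0 ?invr_ge0 ?(ltW (h0 _))// /c.
  case: eqP => _; last by rewrite nr0 invr_ge0 ltW.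
  rewrite nrM nrX nrV nrR gtr0_norm// ler_piMl ?invr_ge0 ?(ltW (h0 _))//.
  by rewrite exprn_ile1// nr_ge0.
exists x; split=> //.
  move=> x0; have := xc i; rewrite x0 inner0l /c modn_small// eqxx divn_small// expr0 hm//.
  by rewrite invr1 mulr1 => /eqP; rewrite eq_sym oner_eq0.
apply: coord_eq0.
  rewrite shiftE bopD; apply: (subspB sM); last exact: (subspZ _ sM).
  by apply: (subspD sM); [exact: MA|exact: ME].
move=> k; rewrite shiftE bopD innerBl innerDl innerZl Ac// Ec !xc /c modnDr.
have [ki|_] := eqVneq (k %% m)%N i; last by rewrite !mulr0 addr0 subr0.
have -> : mu k = mu i.
  rewrite (divn_eq k m) ki addnC; elim: (k %/ m)%N => [|j ih]; first by rewrite addn0.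
  by rewrite mulSn addnCA addnC muS.
rewrite divnDr ?dvdnn// divnn m0 addn1 exprS !rmorphM /= fmorphV /z.
have e0 : eps%:C != 0 :> R[i] by rewrite -[0]/(0%:C) (inj_eq (@complexI R)) gt_eqF.
by have := hn0 k; have := hn0 (k + m) => hkm hk; field; rewrite hk hkm e0.
Qed.

End shift_model.

End disc.

(** * Filling discs by a small perturbation *)

Section disc_perturbation.
Context {R : realType} {H : hilbertType R}.
Implicit Types (x y z : H) (A B S K E : bounded_operator H) (L M : set H).

Definition supported_on L B := (forall x, L (B x)) /\ forall x, orth L x -> B x = 0.

(** K makes approximate eigenvectors at the points of F exact, each point being
    used infinitely often, and E is the weighted shift that fills the discs. The
    closed span M of these vectors is invariant, and off the discs the operator
    on M is invertible with and without E, so that the block lemmas apply. *)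
Theorem disc_perturbation L S (F : seq R[i]) (eps d : R) :
  csubspace L -> maps L S -> 0 < eps -> 0 < d ->
  (forall mu : R[i], mu \in F -> ~ left_sF L (S - mu *: id_bop H)) ->
  exists K E, [/\ supported_on L K, supported_on L E,
    forall x, nr (K x) <= d * nr x, forall x, nr (E x) <= 4 * eps * nr x &
    (forall mu lam : R[i], mu \in F -> nr (lam - mu) <= eps ->
       ~ injective_on L (S + K + E - lam *: id_bop H)) /\
    (forall lam : R[i], (forall mu : R[i], mu \in F -> eps < nr (lam - mu)) ->
       (injective_on L (S + K + E - lam *: id_bop H) ->
        injective_on L (S + K - lam *: id_bop H)) /\
       (surjective_on L (S + K - lam *: id_bop H) ->
        surjective_on L (S + K + E - lam *: id_bop H)))].
Proof.
move=> cL mS e0 d0 nF; have [sL _] := cL.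
have [F0|F0] := posnP (size F).
  have lives0 : supported_on L 0 by split=> // x; exact: (proj1 sL).
  exists 0, 0; split=> //.
  - by move=> x; rewrite nr0 mulr_ge0 ?nr_ge0// ltW.
  - by move=> x; rewrite nr0 !mulr_ge0 ?nr_ge0// ltW.
  - by split=> [mu lam|lam _]; rewrite ?addr0// (size0nil F0).
(* The points of F are used cyclically, so each of them infinitely often. *)
pose m := size F; pose mu k := F`_(k %% m)%N.
have muF k : mu k \in F by rewrite mem_nth// ltn_mod.
have muS k : mu (k + m)%N = mu k by rewrite /mu modnDr.
have [||e [eo Le eS]] := @approximate_eigenvectors _ _ L S mu (d / 2) cL.
- by move=> k; exact: nF.
- by lra.
have [|k|K [Ke KB KL K0]] := small_series_operator eo (g := fun k => mu k *: e k - S (e k)) (d := d / 2).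
- by lra.
- by rewrite nrC.
have [h [h1 hB hm [C C0 hC]]] := @weight_sequence R m F0.
have h0 k : 0 < h k by apply: lt_le_trans (h1 k).
have [|k|E [EM Ec EB]] := weighted_shift eo (a := fun k => (eps * (h (k + m)%N / h k))%:C) m (C := 4 * eps).
- by lra.
- rewrite nrR ger0_norm; last by rewrite mulr_ge0 ?divr_ge0 ?ltW.
  rewrite mulrC ler_pM2r// ler_pdivrMr//.
  by have := hB k 1%N; rewrite mul1n expr2 -natrM.
pose M := closed_span e.
have cM : csubspace M := csub_closed_span e.
have ML : M `<=` L := closed_span_sub cL Le.
have oe x : orth L x -> forall k, inner x (e k) = 0 by move=> ox k; exact: ox.
have AE k : (S + K) (e k) = mu k *: e k by rewrite bopD Ke addrC subrK.
have MA : maps M (S + K).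
  apply: closed_span_sub; first exact: csub_preimage.
  move=> k; suff : M ((S + K) (e k)) by [].
  by rewrite AE; exact: (subspZ _ (proj1 cM) (@closed_span_e _ _ e k)).
(* The vector (S + K)^* e k - (mu k)^* e k is orthogonal to every e j. *)
have Ac x k : M x -> inner ((S + K) x) (e k) = mu k * inner x (e k).
  move=> Mx; apply/eqP; rewrite -subr_eq0; apply/eqP.
  pose u := adjoint (S + K) (e k) - (mu k)^*%R *: e k.
  have <- : inner x u = 0.
    apply: Mx => _ [j _ <-]; rewrite innerBl; apply/eqP; rewrite subr_eq0; apply/eqP.
    rewrite adjointPr AE innerZl innerZr !eo eq_sym.
    by have [->|] := eqVneq j k; rewrite ?mulr0// !mulr1.
  by rewrite innerBr -adjointP innerZr conjCK.
have KL' x : L (K x).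
  by apply: KL => // k; apply: subspB (mS _ (Le k)) => //; exact: subspZ.
exists K, E; split.
- by split=> [|x /oe]; [exact: KL'|exact: K0].
- split=> [x|x /oe ox]; first exact: ML (EM x).
  by apply: (coord_eq0 (EM x)) => k; rewrite Ec ox mulr0.
- by move=> x; apply: le_trans (KB x) _; rewrite divfK ?pnatr_eq0.
- exact: EB.
have AEM x : L x -> M ((S + K + E) x - (S + K) x).
  by move=> _; rewrite bopD addrC addKr; exact: EM.
split=> [nu lam nuF le inj|lam off].
  have im : (index nu F < m)%N by rewrite index_mem.
  have mui : mu (index nu F) = nu by rewrite /mu modn_small// nth_index.
  rewrite -mui in le.
  have [x [Mx x0 Ax]] := shift_eigenvector eo F0 muS e0 h1 MA EM Ac Ec im hm C0 hC le.
  by apply: x0; apply: inj => //; exact: ML.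
have [rho er rF] := separated_from_seq off.
have iD : injective_on M (S + K - lam *: id_bop H).
  apply: (diagonal_injective Ac) => k; apply/eqP => ml.
  by have := off _ (muF k); rewrite ml subrr nr0 ltNge ltW.
have sD : surjective_on M (S + K + E - lam *: id_bop H).
  exact: (shift_surjective eo muS e0 h1 hB MA EM Ac Ec er (fun k => rF _ (muF k))).
have dE x : L x -> M ((S + K + E - lam *: id_bop H) x - (S + K - lam *: id_bop H) x).
  move=> Lx; suff -> : (S + K + E - lam *: id_bop H) x - (S + K - lam *: id_bop H) x =
    (S + K + E) x - (S + K) x by exact: AEM.
  rewrite -[LHS]/((S + K + E) x - lam *: x - ((S + K) x - lam *: x)).
  by rewrite opprB addrA subrK.
split; last exact: (block_surjective sL ML dE sD).
apply: (block_injective sL ML _ iD (proj1 cM) sD) => x Lx.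
by rewrite -opprB; apply: (subspN (proj1 cM)); exact: dE.
Qed.

End disc_perturbation.

(** * Clusters of eigenvectors and the quotient by their span *)

Section clusters.
Context {R : realType} {H : hilbertType R}.
Implicit Types (x y z : H) (A B S K E T : bounded_operator H) (L M : set H).

Lemma countableU (X : Type) (P Q : set X) :
  countable P -> countable Q -> countable (P `|` Q).
Proof.
move=> cP cQ; have := @bigcup_countable bool X setT (fun b => if b then P else Q).
rewrite (_ : \bigcup_(b in _) _ = P `|` Q).
  by apply; [exact: countableP|case].
rewrite eqEsubset; split=> [x [[] _]|x [Px|Qx]]; by [left|right|exists true|exists false].
Qed.

Lemma uncountable_segment (r : R) : 0 < r -> ~ countable [set t : R | 0 < t < r].
Proof.
move=> r0 /countable_lebesgue_measure0.
have -> : [set t : R | 0 < t < r] = [set` `]0, r[].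
  by rewrite eqEsubset; split=> t /=; rewrite in_itv.
rewrite lebesgue_measure_itv /= lte_fin r0 -EFinB => -[] /eqP.
by rewrite subr0 gt_eqF.
Qed.

(** The condition that other eigenvalues occur arbitrarily near is what makes
    the range of T - lam dense in the closed span of E, even when lam is an
    eigenvalue. *)
Definition eigen_cluster T (E : set H) := forall x, E x ->
  exists2 nu : R[i], T x = nu *: x & forall e : R, 0 < e ->
    exists y (nu' : R[i]), [/\ E y, T y = nu' *: y, nu' != nu & nr (x - y) < e].

Definition eigen_clusters T : set H := \bigcup_(E in eigen_cluster T) E.

Definition cluster_span T := hull (eigen_clusters T).

Lemma eigen_clusters_cluster T : eigen_cluster T (eigen_clusters T).
Proof.
move=> x [E cE /cE[nu Tx h]]; exists nu => // e /h[y [nu' [Ey Ty nn xy]]].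
by exists y, nu'; split=> //; exists E.
Qed.

Lemma cluster_span_maps T : maps (cluster_span T) T.
Proof.
move=> x hx; apply: (hx (T @^-1` cluster_span T)).
  by apply: csub_preimage; exact: csub_hull.
move=> y Ey; have [nu Ty _] := eigen_clusters_cluster Ey.
rewrite /preimage/= Ty.
by apply: (subspZ _ (proj1 (csub_hull (eigen_clusters T)))); exact: sub_hull.
Qed.

(** An eigenvector with eigenvalue nu' <> lam is in the image of its own line,
    and the eigenvectors with eigenvalue lam are limits of such vectors. *)
Lemma cluster_span_dense T (lam : R[i]) :
  cluster_span T `<=` adherent ((T - lam *: id_bop H) @` cluster_span T).
Proof.
set V := cluster_span T.
have cV : csubspace V := csub_hull _.
have cI := csub_adherent (image_subsp (T - lam *: id_bop H) (proj1 cV)).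
have in_image y nu' : eigen_clusters T y -> T y = nu' *: y -> nu' != lam ->
    ((T - lam *: id_bop H) @` V) y.
  move=> Ey Ty nl; exists ((nu' - lam)^-1 *: y).
    by apply: (subspZ _ (proj1 cV)); exact: sub_hull.
  rewrite -[LHS]/(T ((nu' - lam)^-1 *: y) - lam *: ((nu' - lam)^-1 *: y)) opZ Ty.
  rewrite !scalerA -scalerBl mulrC -mulrBl mulfV ?scale1r// subr_eq0//.
move=> x hx; apply: hx => // y Ey; have [nu Ty h] := eigen_clusters_cluster Ey.
have [nl|nl] := eqVneq nu lam; last by apply: adherent_sub; exact: in_image Ey Ty nl.
apply: (proj2 cI) => e /h[z [nu' [Ez Tz nn yz]]]; exists z => //.
by apply: adherent_sub; apply: in_image Ez Tz _; rewrite -nl.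
Qed.

(** In a separable space, all but countably many points of an uncountable family
    are condensation points of the family; these form a cluster, because
    eigenvectors with different eigenvalues are different. *)
Lemma cluster_of_segment T (lam : R[i]) (r : R) : separable_space H -> 0 < r ->
  (forall t : R, 0 < t < r -> exists2 x, nr x = 1 & T x = (lam + t%:C) *: x) ->
  exists (t : R) x, [/\ 0 < t < r, cluster_span T x, x <> 0 & T x = (lam + t%:C) *: x].
Proof.
move=> [D cD dD] r0 ev.
have evE (t : R) : exists x, 0 < t < r -> nr x = 1 /\ T x = (lam + t%:C) *: x.
  by have [/ev[x ? ?]|nt] := pselect (0 < t < r : Prop); [exists x|exists 0].
have [x xP] := choice evE.
pose U := [set t : R | 0 < t < r].
pose V (p : H * nat) := [set t | U t /\ nr (x t - p.1) < 2^-1 ^+ p.2].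
pose I := [set p | (D `*` [set: nat]) p /\ countable (V p)].
(* The balls around points of D form a countable base of the topology. The bad
   parameters have their vector in a ball of the base that contains x t for
   only countably many t. *)
pose Bad := \bigcup_(p in I) V p.
have cBad : countable Bad.
  apply: bigcup_countable => [|p [] //].
  apply: (@sub_countable _ _ _ (D `*` [set: nat])); last by apply: countableX => //; exact: countableP.
  by apply: subset_card_le => p [].
pose Good := U `\` Bad.
have [t0 Gt0] : Good !=set0.
  apply/set0P/eqP => G0; apply: (@uncountable_segment r r0).
  apply: sub_countable cBad; apply: subset_card_le => t Ut; apply: contrapT => nB.
  by have : Good t by []; rewrite G0.
have clG : eigen_cluster T (x @` Good).
  move=> _ [t [Ut Bt] <-]; have [xt1 Txt] := xP _ Ut.
  exists (lam + t%:C) => // e e0.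
  have [n nP] : exists n, (2^-1 : R) ^+ n < e / 2 by apply: exprn_small; lra.
  have n0 : 0 < (2^-1 : R) ^+ n by rewrite exprn_gt0//; lra.
  have [d [xd Dd]] : exists d, (ball (x t) (2^-1 ^+ n)%:C `&` D) d.
    apply: dD; last exact: ball_open.
    by exists (x t); apply: ballxx; rewrite ltcR.
  move: xd; rewrite -ball_normE /= nr_lt => xd.
  have Vt : V (d, n) t by split.
  have nV : ~ countable (V (d, n)).
    by move=> cV; apply: Bt; exists (d, n).
  have [s [[Us sd] ns]] : V (d, n) `\` (Bad `|` [set t]) !=set0.
    apply/set0P/eqP => V0; apply: nV.
    apply: sub_countable (countableU cBad (countable1 t)).
    apply: subset_card_le => s Vs; apply: contrapT => nB.
    by have : (V (d, n) `\` (Bad `|` [set t])) s by []; rewrite V0.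
  have [_ Txs] := xP _ Us.
  exists (x s), (lam + s%:C); split=> //.
  - by exists s => //; split=> // Bs; apply: ns; left.
  - apply/eqP => /addrI/complexI st; by apply: ns; right.
  - by have := nr_tri d (x t) (x s); rewrite (nrC d) /= in sd *; lra.
have [xt1 Txt] := xP _ (proj1 Gt0).
exists t0, (x t0); split; [exact: (proj1 Gt0)| | |exact: Txt].
  by apply: sub_hull; exists (x @` Good) => //; exists t0.
by move=> x0; move: xt1; rewrite x0 nr0 => /eqP; rewrite eq_sym oner_eq0.
Qed.

End clusters.

Section quotient.
Context {R : realType} {H : hilbertType R}.
Implicit Types (x y z : H) (A B S K E T : bounded_operator H).
Context (N : set H) (cN : csubspace N).
Let P := proj (orth N).
Let cP : csubspace (orth N) := csub_orth N.

Lemma sub_proj_orth x : N (x - P x).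
Proof. exact: (orthK cN (proj_orth cP x)). Qed.

Lemma proj_orth_eq0 x : N x -> P x = 0.
Proof. by move=> Nx; apply: (proj_eq0 cP) => z oz; apply: inner_sym0; exact: oz. Qed.

Lemma proj_orth_maps A x : maps N A -> P (A x) = P (A (P x)).
Proof.
move=> mA; apply/eqP; rewrite -subr_eq0 -!opB proj_orth_eq0//.
by apply: mA; exact: sub_proj_orth.
Qed.

(** On [orth N], the operator [comp_bop P A] is the one that A induces on the
    quotient by N. A vector of its kernel is corrected by an element of N to a
    vector of the kernel of A. *)
Lemma quotient_injective A : maps N A -> surjective_on N A ->
  injective_on setT A -> injective_on (orth N) (comp_bop P A).
Proof.
move=> mA sA iA v ov Av.
have NA : N (A v) by have := sub_proj_orth (A v); rewrite (_ : P (A v) = 0) ?subr0.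
have [u Nu Au] := sA _ NA.
have /eqP : v - u = 0 by apply: iA => //; rewrite opB Au subrr.
by rewrite subr_eq0 => /eqP vu; apply: (orth_disj _ ov); rewrite vu.
Qed.

Lemma quotient_surjective A : maps N A -> surjective_on setT A ->
  surjective_on (orth N) (comp_bop P A).
Proof.
move=> mA sA y oy; have [//|x _ Ax] := sA y.
exists (P x); first exact: (projL cP).
by rewrite /= -proj_orth_maps// Ax (proj_id cP).
Qed.

Lemma surjective_of_quotient A : surjective_on N A ->
  surjective_on (orth N) (comp_bop P A) -> surjective_on setT A.
Proof.
move=> sN sP y _; have [v ov /= Av] := sP (P y) (projL cP y).
have Ny : N (y - A v).
  have -> : y - A v = (y - P y) - (A v - P (A v)).
    by rewrite Av opprB addrA subrK.
  by apply: (subspB (proj1 cN)); exact: sub_proj_orth.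
have [u Nu Au] := sN _ Ny; exists (u + v) => //.
by rewrite opD Au subrK.
Qed.

Lemma closed_range_of_quotient A : maps N A -> surjective_on N A ->
  left_sF (orth N) (comp_bop P A) -> closed (range A).
Proof.
move=> mA sN lP; apply: csub_closed; split; first exact: range_subsp.
move=> y ay.
have cR : csubspace (comp_bop P A @` orth N).
  by apply: left_sF_closed_range.
have : (comp_bop P A @` orth N) (P y).
  apply: (proj2 cR) => e /ay[_ [x _ <-] yx]; exists (P (A x)).
    by exists (P x); [exact: (projL cP)|rewrite /= -proj_orth_maps].
  by rewrite -opB (le_lt_trans (nr_proj cP _)).
move=> [v ov /= Av].
have Ny : N (y - A v).
  have -> : y - A v = (y - P y) - (A v - P (A v)).
    by rewrite Av opprB addrA subrK.
  by apply: (subspB (proj1 cN)); exact: sub_proj_orth.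
have [u Nu Au] := sN _ Ny; exists (u + v) => //.
by rewrite opD Au subrK.
Qed.

End quotient.

(** * Compactness in the complex plane *)

Section compactness.
Context {R : realType}.

Definition in_box (r : R) (lam : R[i]) :=
  `|complex.Re lam| <= r /\ `|complex.Im lam| <= r.

Lemma nr_Re_Im (z : R[i]) :
  nr z <= `|complex.Re z| + `|complex.Im z|.
Proof.
rewrite {1}[z]complexE (le_trans (nrD _ _))// nrM !nrR lerD//.
rewrite (_ : nr ('i%C : R[i]) = 1) ?mul1r//.
by rewrite /nr normc_def /= expr0n expr1n add0r sqrtr1.
Qed.

Lemma in_box_nr (r : R) (lam : R[i]) : nr lam <= r -> in_box r lam.
Proof.
move=> h; split; apply: le_trans h; rewrite /nr normc_def /= -sqrtr_sqr ler_wsqrtr//.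
  by rewrite lerDl sqr_ge0.
by rewrite lerDr sqr_ge0.
Qed.

Lemma lebesgue_number (r : R) (Phi : R[i] -> R -> Prop) :
  (forall lam d d', d' <= d -> Phi lam d -> Phi lam d') ->
  (forall lam0, in_box r lam0 ->
     exists2 d : R, 0 < d & forall lam, nr (lam - lam0) < d -> Phi lam d) ->
  exists2 d : R, 0 < d & forall lam, in_box r lam -> Phi lam d.
Proof.
move=> mono loc.
pose K := `[- r, r] `*` `[- r, r] : set (R * R).
have cK : compact K by apply: compact_setX; exact: segment_compact.
have := proj1 (compact_near_coveringP K) cK nat \oo
  (fun i x => Phi (x.1 +i* x.2) (2^-1 ^+ i)) _.
case=> [x [/= x1 x2]|n _ nP].
  have [|d d0 dP] := loc (x.1 +i* x.2).
    by move: x1 x2; rewrite !in_itv /= -!ler_norml; split.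
  have d2 : 0 < d / 2 by lra.
  have [n nd] : exists n, (2^-1 : R) ^+ n < d by apply: exprn_small; lra.
  exists ((ball x.1 (d / 2) `*` ball x.2 (d / 2)), [set i | (n <= i)%N]) => /=.
    split; last by exists n.
    exists (ball x.1 (d / 2), ball x.2 (d / 2)) => //=.
    by split; apply: nbhsx_ballx.
  move=> [[a b] i] /= [[]]; rewrite -!ball_normE /= => xa xb ni.
  apply: (@mono _ d); first by rewrite (le_trans _ (ltW nd))// ler_wiXn2l//; lra.
  apply: dP; apply: le_lt_trans (nr_Re_Im _) _ => /=.
  by rewrite distrC (distrC b); lra.
exists (2^-1 ^+ n); first by rewrite exprn_gt0//; lra.
move=> lam [Rl Il]; have /= := nP n (leqnn n) (complex.Re lam, complex.Im lam).
rewrite (_ : complex.Re lam +i* complex.Im lam = lam); last by case: lam {Rl Il}.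
by apply; rewrite /K /= !in_itv /= -!ler_norml.
Qed.

Lemma box_net (r eps : R) : 0 < eps -> exists G : seq R[i],
  forall lam, in_box r lam -> exists2 g, g \in G & nr (lam - g) < eps.
Proof.
move=> e0; pose s := eps / 2; have s0 : 0 < s by rewrite /s; lra.
pose N := (Num.truncn (2 * r / s)).+1.
pose grid k : R := - r + k%:R * s.
have gridP x : `|x| <= r -> exists2 k, (k < N)%N & `|x - grid k| < s.
  rewrite ler_norml => /andP[rx xr]; exists (Num.truncn ((x + r) / s)).
    rewrite ltnS; apply: le_truncn.
    by rewrite ler_pM2r ?invr_gt0//; lra.
  have y0 : 0 <= (x + r) / s by apply: divr_ge0; [lra|exact: ltW].
  have /andP[lo hi] := truncn_itv y0; rewrite ler_pdivlMr// in lo.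
  rewrite ltr_pdivrMr// -natr1 in hi.
  by rewrite /grid; set k := Num.truncn _ in lo hi *; rewrite ltr_norml; lra.
exists [seq grid j +i* grid k | j <- iota 0 N, k <- iota 0 N] => lam [Rl Il].
have [j jN jP] := gridP _ Rl; have [k kN kP] := gridP _ Il.
exists (grid j +i* grid k).
  by apply/allpairsP; exists (j, k); rewrite !mem_iota.
apply: le_lt_trans (nr_Re_Im _) _.
have -> : complex.Re (lam - (grid j +i* grid k)) = complex.Re lam - grid j by case: (lam).
have -> : complex.Im (lam - (grid j +i* grid k)) = complex.Im lam - grid k by case: (lam).
by rewrite /s in jP kP; lra.
Qed.

Lemma subset_net (r eps : R) (P : R[i] -> Prop) : 0 < eps -> exists F : seq R[i],
  (forall mu, mu \in F -> P mu) /\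
  forall lam, in_box r lam -> P lam -> exists2 mu, mu \in F & nr (lam - mu) < eps.
Proof.
move=> e0; have e2 : 0 < eps / 2 by lra.
have [G GP] := box_net r e2.
suff [F [FP FG]] : exists F : seq R[i], (forall mu, mu \in F -> P mu) /\
    forall lam g, g \in G -> nr (lam - g) < eps / 2 -> P lam ->
      exists2 mu, mu \in F & nr (lam - mu) < eps.
  by exists F; split=> // lam /GP[g gG lg] Pl; exact: FG gG lg Pl.
elim: G {GP} => [|g G [F [FP FG]]]; first by exists [::].
have [[nu [Pnu ng]]|nnu] := pselect (exists nu, P nu /\ nr (nu - g) < eps / 2).
  exists (nu :: F); split=> [mu|lam g'].
    by rewrite inE => /orP[/eqP ->//|/FP].
  rewrite inE => /orP[/eqP ->|g'G] lg Pl.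
    exists nu; first exact: mem_head.
    by have := nr_tri g lam nu; rewrite (nrC g); lra.
  by have [mu muF lm] := FG _ _ g'G lg Pl; exists mu; rewrite // inE muF orbT.
exists F; split=> // lam g'; rewrite inE => /orP[/eqP ->|g'G] lg Pl; last exact: FG g'G lg Pl.
by case: nnu; exists lam.
Qed.

End compactness.

(** * Local behaviour off the discs *)

Section local_analysis.
Context {R : realType} {H : hilbertType R}.
Implicit Types (x y z : H) (A B S K E T : bounded_operator H) (L M : set H).

Lemma injective_on_eq L A B : (forall x, L x -> A x = B x) ->
  injective_on L A -> injective_on L B.
Proof. by move=> AB iA x Lx; rewrite -AB//; exact: iA. Qed.

Lemma surjective_on_eq L A B : (forall x, L x -> A x = B x) ->
  surjective_on L A -> surjective_on L B.
Proof. by move=> AB sA y /sA[x Lx <-]; exists x; rewrite ?AB. Qed.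

Lemma left_sF_eq L A B : (forall x, L x -> A x = B x) -> left_sF L A -> left_sF L B.
Proof.
move=> AB [n [p [c [op Lp c0 bA]]]]; exists n, p, c; split=> // x Lx px.
by rewrite -AB//; exact: bA.
Qed.

Lemma left_sF_perturb L A B n (p : 'I_n -> H) (c eta : R) :
  orthonormal_family p -> (forall i, L (p i)) -> 0 < c ->
  (forall x, L x -> perp p x -> nr x <= c * nr (A x)) ->
  eta * c <= 2^-1 -> (forall x, L x -> nr (A x - B x) <= eta * nr x) -> left_sF L B.
Proof.
move=> op Lp c0 bA ec AB; exists n, p, (c * 2); split=> //; first by lra.
move=> x Lx px; apply: (injective_perturb (L := L `&` perp p) c0 _ ec) => // [y [Ly py]|y [Ly _]].
  exact: bA.
exact: AB.
Qed.

Lemma maps_shift L A (lam : R[i]) : lsubspace L -> maps L A ->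
  maps L (A - lam *: id_bop H).
Proof. by move=> sL mA x Lx; apply: (subspB sL (mA _ Lx)); exact: (subspZ _ sL Lx). Qed.

Lemma maps_add L A B : lsubspace L -> maps L A -> maps L B -> maps L (A + B).
Proof. by move=> sL mA mB x Lx; exact: (subspD sL (mA _ Lx) (mB _ Lx)). Qed.

Lemma shift_difference A K (lam lam0 : R[i]) (d : R) x :
  nr (lam - lam0) < d -> nr (K x) <= d * nr x ->
  nr ((A - lam0 *: id_bop H) x - (A + K - lam *: id_bop H) x) <= 2 * d * nr x.
Proof.
move=> ld Kd; rewrite -[X in nr X]/(A x - lam0 *: x - (A x + K x - lam *: x)).
have -> : A x - lam0 *: x - (A x + K x - lam *: x) = (lam - lam0) *: x - K x.
  by rewrite scalerBl opprB [LHS]addrC [A x + _]addrC opprD !addrA subrK addrAC.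
rewrite (le_trans (nrB _ _))// nrZ.
have : nr (lam - lam0) * nr x <= d * nr x by rewrite ler_wpM2r ?nr_ge0// ltW.
by lra.
Qed.

Lemma shift_difference0 A (lam lam0 : R[i]) x :
  nr ((A - lam0 *: id_bop H) x - (A - lam *: id_bop H) x) = nr (lam - lam0) * nr x.
Proof.
rewrite -[X in nr X]/(A x - lam0 *: x - (A x - lam *: x)) -nrZ; congr nr.
by rewrite scalerBl opprB [LHS]addrC addrA subrK.
Qed.

Lemma surjective_near L A (lam0 : R[i]) : csubspace L -> maps L A ->
  surjective_on L (A - lam0 *: id_bop H) ->
  exists2 d : R, 0 < d & forall lam : R[i], nr (lam - lam0) < d ->
    forall K, maps L K -> (forall x, L x -> nr (K x) <= d * nr x) ->
    surjective_on L (A + K - lam *: id_bop H).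
Proof.
move=> cL mA sA; have [sL _] := cL.
have [C C0 CP] := surjective_solves cL (maps_shift _ sL mA) sA.
exists (8^-1 / C) => [|lam ld K mK Kd]; first by rewrite divr_gt0// invr_gt0.
apply: (solves_surjective (C := C * 2)).
have ce : 8^-1 / C * C = 8^-1 by rewrite mulfVK// gt_eqF.
apply: (solves_perturb cL _ (ltW C0) CP (eta := 2 * (8^-1 / C))).
- exact: (maps_shift _ sL (maps_add sL mA mK)).
- by rewrite mulr_ge0// divr_ge0 ?invr_ge0// ltW.
- by rewrite -mulrA ce; lra.
- by move=> x Lx; apply: shift_difference => //; exact: Kd.
Qed.

Lemma large_surjective A (lam : R[i]) : nr A < nr lam ->
  surjective_on setT (A - lam *: id_bop H).
Proof.
move=> Al; have A0 := nr_ge0 A.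
have l0 : 0 < nr lam by lra.
have ln0 : lam != 0 by apply: contraTneq l0 => ->; rewrite nr0 ltxx.
apply: (solves_surjective (C := (nr lam)^-1 / (1 - nr A / nr lam))).
apply: (approximate_solution csub_setT (fun _ _ => Logic.I)).
- by rewrite invr_ge0 ltW.
- by rewrite divr_ge0// ltW.
- by rewrite ltr_pdivrMr// mul1r.
move=> y _; exists (- lam^-1 *: y); split=> //.
  by rewrite scaleNr nrN nrZ nrV.
rewrite -[X in nr X]/(y - (A (- lam^-1 *: y) - lam *: (- lam^-1 *: y))).
rewrite scaleNr opN opZ scalerN scalerA mulfV// scale1r opprD !opprK addrCA subrr addr0.
rewrite nrZ nrV mulrC -mulrA [_ * nr y]mulrC mulrA ler_wpM2r ?invr_ge0 ?nr_ge0//.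
exact: nrT.
Qed.

Section quotient_perturbation.
Context (T : bounded_operator H) (sepH : separable_space H).
Context (hT : forall lam : R[i], (rho_sF T `&` spectrum T) lam ->
  ~ has_dim (kernel (T - lam *: id_bop H)) 0%N).
Let N := cluster_span T.
Let cN : csubspace N := csub_hull _.
Let mN : maps N T := @cluster_span_maps _ _ T.
Let P := proj (orth N).
Let cP : csubspace (orth N) := csub_orth N.
Let S := comp_bop P T.

Lemma cluster_span_surjective (lam : R[i]) : left_sF N (T - lam *: id_bop H) ->
  surjective_on N (T - lam *: id_bop H).
Proof. by move=> l; apply: left_sF_surjective => //; exact: cluster_span_dense. Qed.

Lemma quotient_shift (lam : R[i]) x : orth N x ->
  comp_bop P (T - lam *: id_bop H) x = (S - lam *: id_bop H) x.
Proof.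
move=> ox; rewrite -[LHS]/(P (T x - lam *: x)) opB opZ [P x](proj_id cP)//.
Qed.

Lemma quotient_maps : maps (orth N) S.
Proof. by move=> x _; exact: (projL cP). Qed.

(** By the hypothesis on T it is enough to find mu near lam0 with T - mu
    injective: its range is closed, so mu is in rho_sF T, and T - mu is
    invertible. If there were no such mu on a segment starting at lam0,
    [cluster_of_segment] would give an eigenvector in N, where T - mu is
    injective. *)
Lemma nearby_invertible_quotient (lam0 : R[i]) (r : R) :
  surjective_on N (T - lam0 *: id_bop H) ->
  injective_on N (T - lam0 *: id_bop H) ->
  left_sF (orth N) (S - lam0 *: id_bop H) -> 0 < r ->
  exists2 mu : R[i], nr (mu - lam0) < r &
    injective_on (orth N) (S - mu *: id_bop H) /\
    surjective_on (orth N) (S - mu *: id_bop H).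
Proof.
move=> sN iN [n [p [c [op Lp c0 bS]]]] r0.
have [C C0 CP] := surjective_solves cN (maps_shift _ (proj1 cN) mN) sN.
have bN := solves_injective_bound (proj1 cN) (maps_shift _ (proj1 cN) mN) CP iN.
(* Within s of lam0 the operator on N stays bijective and the operator on the
   quotient stays left semi-Fredholm. *)
pose s := Num.min r (Num.min (C^-1 / 4) (c^-1 / 4)).
have s0 : 0 < s by rewrite !lt_min r0 !divr_gt0 ?invr_gt0.
have sC : s * C <= 4^-1.
  by rewrite -ler_pdivlMr// mulrC !ge_min lexx orbT.
have sc : s * c <= 4^-1.
  by rewrite -ler_pdivlMr// mulrC !ge_min lexx !orbT.
have nrt (t : R) : 0 < t < s -> nr (lam0 + t%:C - lam0) = t.
  by move=> /andP[t0 _]; rewrite addrAC subrr add0r nrR gtr0_norm.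
have near_t (t : R) A x : 0 < t < s ->
    nr ((A - lam0 *: id_bop H) x - (A - (lam0 + t%:C) *: id_bop H) x) <= s * nr x.
  by move=> ts; rewrite shift_difference0 nrt// ler_wpM2r ?nr_ge0//; case/andP: ts => _ /ltW.
have iNt (t : R) : 0 < t < s -> injective_on N (T - (lam0 + t%:C) *: id_bop H).
  move=> ts; apply: (bounded_below_injective (C := C * 2)).
  by apply: (injective_perturb C0 bN (eta := s)); [lra|move=> x _; exact: near_t].
have [t [ts it]] : exists t : R, 0 < t < s /\ injective_on setT (T - (lam0 + t%:C) *: id_bop H).
  apply: contrapT => nt.
  have [|t [x [ts Nx x0 Tx]]] := @cluster_of_segment _ _ T lam0 s sepH s0.
    move=> t ts; apply: contrapT => nx; apply: nt; exists t; split=> // x _ Tx.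
    apply: contrapT => /eqP x0; apply: nx.
    have nx0 := nr_gt0 x0.
    exists ((nr x)^-1%:C *: x).
      by rewrite nrZ nrR gtr0_norm ?invr_gt0// mulVf// gt_eqF.
    rewrite opZ; have /eqP := Tx; rewrite -[X in X == 0]/(T x - (lam0 + t%:C) *: x) subr_eq0 => /eqP ->.
    by rewrite !scalerA mulrC.
  apply: x0; apply: (iNt t ts) => //.
  by rewrite -[LHS]/(T x - (lam0 + t%:C) *: x) Tx subrr.
set mu := lam0 + t%:C in it *.
have mNm : maps N (T - mu *: id_bop H) := maps_shift _ (proj1 cN) mN.
have sNm : surjective_on N (T - mu *: id_bop H).
  apply: (solves_surjective (C := C * 2)).
  apply: (solves_perturb cN mNm (ltW C0) CP (eta := s)); [exact: ltW|lra|].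
  by move=> x _; exact: near_t.
have lm : left_sF (orth N) (comp_bop P (T - mu *: id_bop H)).
  apply: (@left_sF_eq _ (S - mu *: id_bop H)); first by move=> x ox; rewrite quotient_shift.
  by apply: (left_sF_perturb op Lp c0 bS (eta := s)); [lra|move=> x _; exact: near_t].
have clm := closed_range_of_quotient cN mNm sNm lm.
have kd0 := (proj2 (has_dim0P (T - mu *: id_bop H))) it.
have inv : invertible (T - mu *: id_bop H).
  apply: contrapT => ninv; apply: (hT _ kd0); split=> //.
  by split=> //; left; exists 0%N.
have [_ st] := invertible_bijective inv.
exists mu; first by rewrite nrt//; case/andP: ts => _ /lt_le_trans; apply; rewrite ge_min lexx.
split.
  apply: (injective_on_eq (@quotient_shift mu)).
  exact: (quotient_injective cN mNm sNm it).
apply: (surjective_on_eq (@quotient_shift mu)).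
exact: (quotient_surjective cN mNm st).
Qed.

(** If T - lam0 has a kernel in N, this kernel persists and the injectivity
    hypothesis fails. Otherwise the operator on the quotient is near a bijective
    one, and the Fredholm alternative applies. *)
Lemma local_alternative (lam0 : R[i]) :
  surjective_on N (T - lam0 *: id_bop H) -> left_sF (orth N) (S - lam0 *: id_bop H) ->
  exists2 d : R, 0 < d & forall lam : R[i], nr (lam - lam0) < d -> forall K1 K2,
    maps N K1 -> (forall x, N x -> nr (K1 x) <= d * nr x) ->
    maps (orth N) K2 -> (forall x, orth N x -> nr (K2 x) <= d * nr x) ->
    injective_on N (T + K1 - lam *: id_bop H) ->
    injective_on (orth N) (S + K2 - lam *: id_bop H) ->
    surjective_on (orth N) (S + K2 - lam *: id_bop H).
Proof.
move=> sN lS.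
have [iN|niN] := pselect (injective_on N (T - lam0 *: id_bop H)); last first.
  have [C C0 CP] := surjective_solves cN (maps_shift _ (proj1 cN) mN) sN.
  have ce : 8^-1 / C * C = 8^-1 by rewrite mulfVK// gt_eqF.
  exists (8^-1 / C); first by rewrite divr_gt0// invr_gt0.
  move=> lam ld K1 K2 mK1 K1d _ _ iT; exfalso; move: iT.
  apply: (kernel_perturb cN _ (ltW C0) CP (eta := 2 * (8^-1 / C)) _ _ _ niN).
  - exact: (maps_shift _ (proj1 cN) (maps_add (proj1 cN) mN mK1)).
  - by rewrite mulr_ge0// divr_ge0 ?invr_ge0// ltW.
  - by rewrite -mulrA ce; lra.
  - by move=> x Nx; apply: shift_difference => //; exact: K1d.
have [n [p [c [op Lp c0 bS]]]] := lS.
have e0 : 0 < 8^-1 / c by rewrite divr_gt0// invr_gt0.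
have [mu mul [imu smu]] := nearby_invertible_quotient sN iN lS e0.
exists (8^-1 / c / 2); first by rewrite divr_gt0.
move=> lam ld K1 K2 _ _ mK2 K2d _.
apply: (fredholm_alternative_near cP op Lp c0 bS _ imu smu _ (ltW e0)).
- exact: (maps_shift _ (proj1 cP) quotient_maps).
- exact: (maps_shift _ (proj1 cP) (maps_add (proj1 cP) quotient_maps mK2)).
- by rewrite mulfVK// gt_eqF.
- by move=> x _; rewrite shift_difference0 ler_wpM2r ?nr_ge0// ltW.
- move=> x ox; apply: le_trans (shift_difference _ ld (K2d _ ox)) _.
  by rewrite [2 * _]mulrC divfK// pnatr_eq0.
Qed.

End quotient_perturbation.

End local_analysis.

(** * Approximation *)

Section approximation.
Context {R : realType} {H : hilbertType R}.
Implicit Types (x y z : H) (A B S K E T : bounded_operator H) (L M : set H).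

Lemma spectrum_eq_point_spectrum T :
  (forall lam : R[i], injective_on setT (T - lam *: id_bop H) ->
     surjective_on setT (T - lam *: id_bop H)) ->
  point_spectrum T = spectrum T.
Proof.
move=> is_; rewrite eqEsubset; split=> lam.
  by move=> kn /invertible_bijective[iT _]; apply: kn; apply/kernel_trivialP.
move=> ninv /kernel_trivialP iT; apply: ninv.
by apply: bijective_invertible => //; exact: is_.
Qed.

(** Near a point that is closer than eps to F1 or F2 the corresponding condition
    is void; near all other points of the square the local results apply. *)
Lemma uniform_perturbation T (r eps : R) (F1 F2 : seq R[i]) : separable_space H ->
  (forall lam : R[i], (rho_sF T `&` spectrum T) lam ->
    ~ has_dim (kernel (T - lam *: id_bop H)) 0%N) ->
  let N := cluster_span T in let S := comp_bop (proj (orth N)) T in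
  (forall lam : R[i], (forall mu, mu \in F1 -> eps <= nr (lam - mu)) ->
     in_box r lam -> left_sF N (T - lam *: id_bop H)) ->
  (forall lam : R[i], (forall mu, mu \in F2 -> eps <= nr (lam - mu)) ->
     in_box r lam -> left_sF (orth N) (S - lam *: id_bop H)) ->
  exists2 d : R, 0 < d & forall lam : R[i], in_box r lam ->
    (forall mu, mu \in F1 -> eps < nr (lam - mu)) ->
    forall K1, maps N K1 -> (forall x, N x -> nr (K1 x) <= d * nr x) ->
    surjective_on N (T + K1 - lam *: id_bop H) /\
    ((forall mu, mu \in F2 -> eps < nr (lam - mu)) ->
     forall K2, maps (orth N) K2 -> (forall x, orth N x -> nr (K2 x) <= d * nr x) ->
     injective_on N (T + K1 - lam *: id_bop H) ->
     injective_on (orth N) (S + K2 - lam *: id_bop H) ->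
     surjective_on (orth N) (S + K2 - lam *: id_bop H)).
Proof.
move=> sepH hT N S lsN lsP.
have cN : csubspace N := csub_hull _.
pose Phi (lam : R[i]) (d : R) := in_box r lam -> 
    (forall mu, mu \in F1 -> eps < nr (lam - mu)) ->
    forall K1, maps N K1 -> (forall x, N x -> nr (K1 x) <= d * nr x) ->
    surjective_on N (T + K1 - lam *: id_bop H) /\
    ((forall mu, mu \in F2 -> eps < nr (lam - mu)) ->
     forall K2, maps (orth N) K2 -> (forall x, orth N x -> nr (K2 x) <= d * nr x) ->
     injective_on N (T + K1 - lam *: id_bop H) ->
     injective_on (orth N) (S + K2 - lam *: id_bop H) ->
     surjective_on (orth N) (S + K2 - lam *: id_bop H)).
have cP : csubspace (orth N) := csub_orth N.
suff [d d0 dP] : exists2 d : R, 0 < d & forall lam, in_box r lam -> Phi lam d.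
  by exists d => // lam bl; exact: dP.
have far (F : seq R[i]) (lam0 : R[i]) :
    (exists2 d : R, 0 < d & forall lam, nr (lam - lam0) < d ->
      ~ forall mu, mu \in F -> eps < nr (lam - mu)) \/
    (forall mu, mu \in F -> eps <= nr (lam0 - mu)).
  have [[mu [muF lt]]|nmu] := pselect (exists mu, mu \in F /\ nr (lam0 - mu) < eps).
    left; exists (eps - nr (lam0 - mu)) => [|lam ld off]; first by rewrite subr_gt0.
    by have := off _ muF; have := nr_tri lam0 lam mu; lra.
  right => mu muF; rewrite leNgt; apply/negP => lt; by apply: nmu; exists mu.
apply: lebesgue_number => [lam d d' d'd Pd bl off1 K1 mK1 K1d|lam0 b0].
  have mono L K : (forall x, L x -> nr (K x) <= d' * nr x) ->
      forall x, L x -> nr (K x) <= d * nr x.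
    by move=> Kd x Lx; apply: le_trans (Kd _ Lx) _; rewrite ler_wpM2r ?nr_ge0.
  have [sN alt] := Pd bl off1 K1 mK1 (mono _ _ K1d); split=> // off2 K2 mK2 K2d.
  exact: (alt off2 K2 mK2 (mono _ _ K2d)).
have [[d d0 dP]|off1] := far F1 lam0.
  by exists d => // lam ld bl /(dP _ ld).
have l1 := lsN _ off1 b0; have s1 := cluster_span_surjective l1.
have [d1 d10 d1P] := surjective_near cN (@cluster_span_maps _ _ T) s1.
have shrink (d d' : R) L K : d <= d' -> (forall x, L x -> nr (K x) <= d * nr x) ->
    forall x, L x -> nr (K x) <= d' * nr x.
  by move=> dd' Kd x Lx; apply: le_trans (Kd _ Lx) _; rewrite ler_wpM2r ?nr_ge0.
have [[d d0 dP]|off2] := far F2 lam0.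
  exists (Num.min d d1); first by rewrite lt_min d0.
  move=> lam; rewrite lt_min => /andP[ld ld1] bl _ K1 mK1 K1d; split; last by move/(dP _ ld).
  by apply: d1P => //; apply: shrink K1d; rewrite ge_min lexx orbT.
have [d2 d20 d2P] := local_alternative sepH hT s1 (lsP _ off2 b0).
exists (Num.min d1 d2); first by rewrite lt_min d10.
move=> lam; rewrite lt_min => /andP[ld1 ld2] bl _ K1 mK1 K1d; split.
  by apply: d1P => //; apply: shrink K1d; rewrite ge_min lexx.
move=> _ K2 mK2 K2d; apply: d2P => //; [apply: shrink K1d|apply: shrink K2d];
  by rewrite ge_min lexx orbT.
Qed.

Lemma approximation T : separable_space H ->
  (forall lam : R[i], (rho_sF T `&` spectrum T) lam ->
    ~ has_dim (kernel (T - lam *: id_bop H)) 0%N) ->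
  forall e : R, 0 < e ->
  exists2 T' : bounded_operator H, point_spectrum T' = spectrum T' & nr (T - T') < e.
Proof.
move=> sepH hT e e0.
pose N := cluster_span T; pose P := proj (orth N); pose S := comp_bop P T.
have cN : csubspace N := csub_hull _.
have cP : csubspace (orth N) := csub_orth N.
have mN : maps N T := @cluster_span_maps _ _ T.
have mP : maps (orth N) S by move=> x _; exact: (projL cP).
(* The corrections K1, K2 have norm at most eps, the shifts E1, E2 at most
   4 eps, and 10 eps < e / 2. As the norm of T' is at most r, the points outside
   the square are in the resolvent set of T'. *)
pose r := nr T + e; pose eps := e / 32.
have eps0 : 0 < eps by rewrite /eps; lra.
have [F1 [nF1 F1P]] := @subset_net R r eps (fun lam => ~ left_sF N (T - lam *: id_bop H)) eps0.
have [F2 [nF2 F2P]] := @subset_net R r eps (fun lam => ~ left_sF (orth N) (S - lam *: id_bop H)) eps0.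
have [||d d0 dP] := @uniform_perturbation T r eps F1 F2 sepH hT.
- move=> lam off bl; apply: contrapT => /(F1P _ bl)[mu muF].
  by apply/negP; rewrite -leNgt; exact: off.
- move=> lam off bl; apply: contrapT => /(F2P _ bl)[mu muF].
  by apply/negP; rewrite -leNgt; exact: off.
pose d' := Num.min d eps.
have d'0 : 0 < d' by rewrite lt_min d0.
have d'd : d' <= d by rewrite ge_min lexx.
have d'e : d' <= eps by rewrite ge_min lexx orbT.
have [K1 [E1 [[K1N K1o] [E1N E1o] K1d E1d [in1 out1]]]] := disc_perturbation cN mN eps0 d'0 nF1.
have [K2 [E2 [[K2N K2o] [E2N E2o] K2d E2d [in2 out2]]]] := disc_perturbation cP mP eps0 d'0 nF2.
pose T' : bounded_operator H := T + K1 + E1 + (K2 + E2).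
have oo x : N x -> orth (orth N) x by move=> Nx z oz; apply: inner_sym0; exact: oz.
have TN (lam : R[i]) x : N x ->
    (T + K1 + E1 - lam *: id_bop H) x = (T' - lam *: id_bop H) x.
  move=> /oo ox; rewrite -[RHS]/(T x + K1 x + E1 x + (K2 x + E2 x) - lam *: x).
  by rewrite K2o// E2o// !addr0.
have TP (lam : R[i]) x : orth N x ->
    comp_bop P (T' - lam *: id_bop H) x = (S + K2 + E2 - lam *: id_bop H) x.
  move=> ox; rewrite -[LHS]/(P (T x + K1 x + E1 x + (K2 x + E2 x) - lam *: x)).
  rewrite K1o// E1o// !addr0 addrA opB !opD opZ.
  by rewrite [P (K2 x)](proj_id cP)// [P (E2 x)](proj_id cP)// [P x](proj_id cP).
have bound x : nr ((T - T') x) <= e / 2 * nr x.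
  rewrite -[X in nr X]/(T x - (T x + K1 x + E1 x + (K2 x + E2 x))).
  have -> : T x - (T x + K1 x + E1 x + (K2 x + E2 x)) = - (K1 x + (E1 x + (K2 x + E2 x))).
    by rewrite -[T x + _ + _ + _]addrA -[T x + _ + _]addrA opprD [LHS]addrA subrr add0r.
  rewrite nrN.
  have := nrD (K1 x) (E1 x + (K2 x + E2 x)); have := nrD (E1 x) (K2 x + E2 x).
  have := nrD (K2 x) (E2 x); have := K1d x; have := K2d x; have := E1d x; have := E2d x.
  have : d' * nr x <= eps * nr x by rewrite ler_wpM2r// nr_ge0.
  have : 0 <= eps * nr x by rewrite mulr_ge0 ?nr_ge0// ltW.
  by rewrite /eps; lra.
have TT' : nr (T - T') <= e / 2 by apply: nrT_le => //; lra.
exists T'; last by lra.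
apply: spectrum_eq_point_spectrum => lam iT.
have [big|small] := ltP (nr T') (nr lam); first exact: large_surjective.
have bl : in_box r lam.
  apply: in_box_nr; rewrite (le_trans small)// /r.
  by have := nrB T (T - T'); rewrite opprB addrC subrK; lra.
have iN' : injective_on N (T + K1 + E1 - lam *: id_bop H).
  by move=> x Nx; rewrite TN// => Tx; exact: iT.
have off1 mu : mu \in F1 -> eps < nr (lam - mu).
  by move=> muF; rewrite ltNge; apply/negP => le; apply: (in1 mu lam).
have [sN alt] := dP lam bl off1 K1 (fun x _ => K1N x)
  (fun x _ => le_trans (K1d x) (ler_wpM2r (nr_ge0 x) d'd)).
have [back1 /(_ sN) sN1] := out1 _ off1; have iN := back1 iN'.
have sNT := surjective_on_eq (@TN lam) sN1.
have mT' : maps N (T' - lam *: id_bop H).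
  move=> x Nx; rewrite -TN//; apply: (maps_shift lam (proj1 cN) _ Nx).
  by apply: (maps_add (proj1 cN)); [apply: (maps_add (proj1 cN))|] => // y _.
have iP' := injective_on_eq (@TP lam) (quotient_injective cN mT' sNT iT).
have off2 mu : mu \in F2 -> eps < nr (lam - mu).
  by move=> muF; rewrite ltNge; apply/negP => le; apply: (in2 mu lam).
have [back2 fwd2] := out2 _ off2.
have sP := fwd2 (alt off2 K2 (fun x _ => K2N x)
  (fun x _ => le_trans (K2d x) (ler_wpM2r (nr_ge0 x) d'd)) iN (back2 iP')).
apply: (surjective_of_quotient cN sNT).
by apply: surjective_on_eq sP => x ox; rewrite TP.
Qed.

End approximation.

Theorem theorem5p6 (R : realType) (H : hilbertType R)
    (H_separable : separable_space H) :
  closure [set T : bounded_operator H | point_spectrum T = spectrum T] =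
  [set T : bounded_operator H |
    forall lambda : R[i], (rho_sF T `&` spectrum T) lambda ->
      ~ has_dim (kernel (T - lambda *: id_bop H)) 0%N].
Proof.
rewrite eqEsubset; split=> T; first exact: closure_sub.
by move=> hT; apply/closure_opnorm => e e0; exact: approximation.
Qed.
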